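(* Let $\mu$ be a probability measure on $\Omega$ satisfying (A1), (A2), (A3) and (A4), and let $\omega\sim\mu$. Let $\phi_1$ denote the union of all primal contours of $\phi(\omega)$, and let $G\setminus\phi_1$ be the graph obtained from $G$ by removing every edge of $G$ that is crossed by a present edge of $\mathbb{L}_1$. Then almost surely $G\setminus\phi_1$ has no infinite connected components.
   Context: Let $G$ be the square grid with vertex set $\mathbb{Z}^2$ and nearest-neighbour edges (edges viewed as unit segments in $\mathbb{R}^2$). The face of $G$ with lower-left corner $(m,n)$ is black if $m+n$ is even, white otherwise. $\Omega\subset\{0,1\}^{\mathbb{Z}^2}$ is the set of $\omega$ such that for every black face the states of its four vertices, listed clockwise from the lower-left corner, form one of $0000,1111,0011,1100,0110,1001$. Let $\mathbb{L}_1$ be the graph with vertices $(m-\tfrac12,n+\tfrac12)$, $m,n$ both even, and $\mathbb{L}_2$ the graph with vertices $(m-\tfrac12,n+\tfrac12)$, $m,n$ both odd; in each, two vertices are joined by an edge (a segment of length 2) iff at Euclidean distance $2$. The center of each black face $F$ is the midpoint of exactly one edge $e_1$ of $\mathbb{L}_1$ and one edge $e_2$ of $\mathbb{L}_2$ (perpendicular). For $\omega\in\Omega$ define $\phi(\omega)\in\{0,1\}^{E(\mathbb{L}_1)\cup E(\mathbb{L}_2)}$: if the configuration around $F$ is $0000$ or $1111$ both $e_1,e_2$ get $0$; if the two upper vertices share a state different from the two lower ones, the horizontal one of $e_1,e_2$ gets $1$, the vertical $0$; if the two left vertices share a state different from the two right ones, the vertical one gets $1$, the horizontal $0$. Edges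 with value $1$ are present; contours are connected components of present edges; a primal contour consists of edges of $\mathbb{L}_1$. Assumptions on $\mu$: (A1) invariance under translations by the group generated by $(1,1),(1,-1)$; (A2) every $2\mathbb{Z}\times2\mathbb{Z}$-translation-invariant event has probability $0$ or $1$; (A3) invariance under $\theta(\omega)=1-\omega$; (A4) if $\nu_1$ is the law of the restriction of $\phi(\omega)$ to $E(\mathbb{L}_1)$, then for every face $S$ of $\mathbb{L}_1$ and every event $E$ with $\nu_1(E)>0$ we have $\nu_1(E_S)>0$, where $E_S=\{\psi_S:\psi\in E\}$ and $\psi_S$ is obtained from $\psi$ by flipping the states of the four sides of $S$. *)

(* Defs.v *)
From HB Require Import structures.
From mathcomp Require Import all_boot all_order all_algebra.
From mathcomp Require Import all_classical all_reals all_analysis.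
From Stdlib Require Import Relations.
Set Implicit Arguments. Unset Strict Implicit. Unset Printing Implicit Defensive.
Import Order.TTheory GRing.Theory Num.Theory.
Local Open Scope classical_set_scope.
Local Open Scope ring_scope.

Definition Z2 := (int * int)%type.

Definition config := Z2 -> bool.

Definition cyl : set (set config) :=
  [set A | exists (x : Z2) (b : bool), A = [set w : config | w x = b]].
Definition Cfg := g_sigma_algebraType cyl.

(* the face with lower-left corner (m,n) is black iff m+n is even *)
Definition black (f : Z2) : bool := (2 %| f.1 + f.2)%Z.

Definition ll (f : Z2) : Z2 := f.
Definition ul (f : Z2) : Z2 := (f.1, f.2 + 1).
Definition ur (f : Z2) : Z2 := (f.1 + 1, f.2 + 1).
Definition lr (f : Z2) : Z2 := (f.1 + 1, f.2).

Definition allowed (a b c d : bool) : bool :=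
  [|| [&& ~~ a, ~~ b, ~~ c & ~~ d],
      [&& a, b, c & d],
      [&& ~~ a, ~~ b, c & d],
      [&& a, b, ~~ c & ~~ d],
      [&& ~~ a, b, c & ~~ d]
    | [&& a, ~~ b, ~~ c & d]].

Definition in_Omega (w : config) : Prop :=
  forall f : Z2, black f -> allowed (w (ll f)) (w (ul f)) (w (ur f)) (w (lr f)).

(* value given by phi to the horizontal (resp. vertical) edge through the
   center of the black face f: the two upper vertices share a state different
   from the two lower ones (resp. left vs right) *)
Definition horiz_val (w : config) (f : Z2) : bool :=
  [&& w (ul f) == w (ur f), w (ll f) == w (lr f) & w (ul f) != w (ll f)].
Definition vert_val (w : config) (f : Z2) : bool :=
  [&& w (ll f) == w (ul f), w (lr f) == w (ur f) & w (ll f) != w (lr f)].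

(* Vertices of L1: the point (m - 1/2, n + 1/2) is encoded by (m,n), m,n even.
   An edge of L1 is encoded by its lower/left endpoint (m,n) and a boolean:
   true = horizontal edge to (m+3/2, n+1/2), false = vertical edge to
   (m-1/2, n+5/2). *)
Definition evenZ2 (p : Z2) : bool := (2 %| p.1)%Z && (2 %| p.2)%Z.
Definition L1edge := {e : Z2 * bool | evenZ2 e.1}.
Definition ebase (e : L1edge) : Z2 := (sval e).1.
Definition ehoriz (e : L1edge) : bool := (sval e).2.

(* black face whose center is the midpoint of e *)
Definition eface (e : L1edge) : Z2 :=
  if ehoriz e then ebase e else ((ebase e).1 - 1, (ebase e).2 + 1).

Definition phi1 (w : config) : L1edge -> bool :=
  fun e => if ehoriz e then horiz_val w (eface e) else vert_val w (eface e).

Definition L1config := L1edge -> bool.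
Definition cylE : set (set L1config) :=
  [set A | exists (e : L1edge) (b : bool), A = [set p : L1config | p e = b]].
Definition L1Cfg := g_sigma_algebraType cylE.

(* A face S of L1 is encoded by its lower-left vertex (m,n) (m,n even):
   sides: bottom/top horizontal edges at (m,n),(m,n+2), left/right vertical
   edges at (m,n),(m+2,n). *)
Definition side_of (S : Z2) (e : L1edge) : bool :=
  (sval e == (S, true)) || (sval e == ((S.1, S.2 + 2), true)) ||
  (sval e == (S, false)) || (sval e == ((S.1 + 2, S.2), false)).

Definition flipS (S : Z2) (p : L1config) : L1config :=
  fun e => if side_of S e then ~~ p e else p e.

Definition nn (u v : Z2) : Prop :=
  v = (u.1 + 1, u.2) \/ v = (u.1 - 1, u.2) \/
  v = (u.1, u.2 + 1) \/ v = (u.1, u.2 - 1).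

Definition crossed_pair (e : L1edge) (u v : Z2) : Prop :=
  let m := (ebase e).1 in let n := (ebase e).2 in
  if ehoriz e then
    (u = (m, n) /\ v = (m, n + 1)) \/ (u = (m + 1, n) /\ v = (m + 1, n + 1))
  else
    (u = (m - 1, n + 1) /\ v = (m, n + 1)) \/
    (u = (m - 1, n + 2) /\ v = (m, n + 2)).
Definition crosses (e : L1edge) (u v : Z2) : Prop :=
  crossed_pair e u v \/ crossed_pair e v u.

Definition adj_minus (w : config) (u v : Z2) : Prop :=
  nn u v /\ ~ (exists e : L1edge, phi1 w e /\ crosses e u v).

Definition conn_minus (w : config) : relation Z2 :=
  clos_refl_trans Z2 (adj_minus w).

Definition transl (a : Z2) (w : config) : config :=
  fun x => w (x.1 + a.1, x.2 + a.2).
Definition theta (w : config) : config := fun x => ~~ w x.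

(* Main.v *)
(* On Omega the jumps of w across L1-type edges form a closed 1-form mod 2 on Z^2,
   so they are the jumps of a spin field sigma; put tau := w + sigma (mod 2). The
   components of G \ phi_1 are the monochromatic clusters of sigma, on each unit
   face sigma or tau is constant, and translation by (1,1) exchanges the roles of
   sigma and tau.

   Parity. By (A3), exchanging w and 1 - w fixes sigma and negates tau. If a
   translation-covariant rule, blind to the global signs of sigma and tau, selects
   pairs of sites (u,v) on which sigma(u) + tau(v) takes a single value, then both
   values of this sum are equally likely, against (A2). So almost surely any such
   rule selects nothing or produces both values.

   Infinite clusters. By (A4), almost sure properties of sigma survive the flip of
   finitely many 2x2 blocks. A Burton-Keane argument then excludes three infinite
   clusters of one sign. If one sign had strictly more infinite clusters than the
   other, the same would hold for tau, against parity; two infinite clusters of one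
   sign (hence of both) could be turned into such a majority by filling a tile. So if
   there is an infinite cluster, there is exactly one of each sign, for sigma and for
   tau. By planarity tau is constant along the side of the interface in each of the
   two sigma-clusters; by parity for the pairs (v,v), v running over both sides, it
   is the same constant on both sides. Likewise sigma is constant along the interface
   of tau, and parity fails for the pairs (u,v) with u on the tau-interface and v on
   the sigma-interface. *)

Require Import Defs.
From HB Require Import structures.
From mathcomp Require Import all_boot all_order all_algebra.
From mathcomp Require Import all_classical all_reals all_analysis measurable_realfun.
From mathcomp Require Import zify.
From Stdlib Require Import Relations.
Set Implicit Arguments. Unset Strict Implicit. Unset Printing Implicit Defensive.
Import Order.TTheory GRing.Theory Num.Theory.
Local Open Scope classical_set_scope.
Local Open Scope ring_scope.

(** * Trifurcations in graphs *)

Section Graph.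
Variables (V : Type) (r : V -> V -> Prop).
Hypothesis r_sym : forall u v, r u v -> r v u.

Definition avoid (B : set V) u v := [/\ r u v, ~ B u & ~ B v].
Definition con (B : set V) := clos_refl_trans V (avoid B).

Lemma con_refl B u : con B u u. Proof. exact: rt_refl. Qed.

Lemma con_trans B u v w : con B u v -> con B v w -> con B u w.
Proof. exact: rt_trans. Qed.

Lemma con_step B u v : r u v -> ~ B u -> ~ B v -> con B u v.
Proof. by move=> *; apply: rt_step. Qed.

Lemma con_sym B u v : con B u v -> con B v u.
Proof.
elim=> [x y [rxy Bx By]|x|x y z _ yx _ zy]; last exact: con_trans zy yx.
- by apply: con_step => //; apply: r_sym.
- exact: con_refl.
Qed.

Lemma con_avoids B u v : con B u v -> ~ B u -> ~ B v.
Proof. by elim=> [x y []|x|x y z _ IH1 _ IH2] // /IH1. Qed.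

Lemma con_switch B B' u v :
  (forall x, con B u x -> ~ B' x) -> con B u v -> con B' u v.
Proof.
move=> uB' /clos_rt_rtn1_iff; elim=> [|y z [ryz By Bz] uy IH].
  exact: con_refl.
apply: con_trans IH _; apply: con_step => //; apply: uB'.
  exact: clos_rtn1_rt uy.
by apply: con_trans (clos_rtn1_rt _ _ _ _ uy) _; apply: con_step.
Qed.

Lemma con_sub B B' u v : B' `<=` B -> con B u v -> con B' u v.
Proof.
move=> BB'; elim=> [x y [rxy Bx By]|x|x y z _ xy _ yz].
- by apply: con_step => // /BB'.
- exact: con_refl.
- exact: con_trans xy yz.
Qed.

Lemma con_hit B u b : con set0 u b -> ~ B u -> B b ->
  exists x c, [/\ con B u x, r x c & B c].
Proof.
move=> /clos_rt_rt1n_iff; elim=> [x Bx /Bx //|x y z [rxy _ _] _ IH Bx Bz].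
have [By|By] := pselect (B y); first by exists x, y; split=> //; apply: con_refl.
have [x' [c [yx' x'c Bc]]] := IH By Bz.
by exists x', c; split=> //; apply: con_trans yx'; apply: con_step.
Qed.

Section Trifurcations.
Variables (I : eqType) (B : I -> set V).
Hypothesis B_conn : forall i b c, B i b -> B i c -> con (~` B i) b c.
Hypothesis B_disj : forall i j x, i != j -> B i x -> ~ B j x.

Definition arms (Y : set V) (i : I) (y : 'I_3 -> V) :=
  (forall a, [/\ Y (y a), ~ B i (y a) & exists2 b, B i b & con set0 (y a) b]) /\
  (forall a b, a != b -> ~ con (B i) (y a) (y b)).

Lemma B_con i j b c : i != j -> B i b -> B i c -> con (B j) b c.
Proof.
move=> ij Bb Bc; apply: con_sub (B_conn Bb Bc) => x Bjx Bix.
exact: B_disj ij Bix Bjx.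
Qed.

(* As B_j is connected, at most one arm of i runs into it. *)
Lemma arm_choice Y i j y a b : arms Y i y -> i != j -> a != b ->
  exists2 c, c = a \/ c = b & forall x, con (B i) (y c) x -> ~ B j x.
Proof.
move=> [_ yN] ij ab.
have [h|h] := pselect (forall x, con (B i) (y a) x -> ~ B j x).
  by exists a => //; left.
exists b; first by right.
move=> x bx Bx; apply: h => x' ax' Bx'; apply: (yN _ _ ab).
apply: con_trans ax' _; apply: con_trans (con_sym bx).
by apply: B_con Bx' Bx; rewrite eq_sym.
Qed.

Lemma arm_root Y i j y a : arms Y i y -> i != j ->
  (forall x, con (B i) (y a) x -> ~ B j x) ->
  forall c, B i c -> con (B j) (y a) c.
Proof.
move=> [yY _] ij yj c Bc; have [_ Bya [b Bb yb]] := yY a.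
have [x [d [yx xd Bd]]] := con_hit yb Bya Bb.
apply: con_trans (con_switch yj yx) _.
apply: con_trans (B_con ij Bd Bc); apply: con_step xd _ _; first exact: yj.
exact: B_disj ij Bd.
Qed.

(* If an arm of B_i meets B_j, then an arm of B_j avoiding B_i is contained in it and
   meets fewer of the sets. *)
Lemma leaf_exists (T : seq I) Y (z : I -> 'I_3 -> V) i (a : 'I_3) :
  (forall j, j \in T -> arms Y j (z j)) -> i \in T ->
  exists i' (a' : 'I_3), i' \in T /\
    forall j x, j \in T -> con (B i') (z i' a') x -> ~ B j x.
Proof.
move=> zT; pose m (i : I) (a : 'I_3) j := `[< exists2 x, con (B i) (z i a) x & B j x >].
have [n] := ubnP (count (m i a) T).
elim: n i a => // n IH i a mn iT.
have [h|h] := pselect (forall j x, j \in T -> con (B i) (z i a) x -> ~ B j x).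
  by exists i, a.
have [j [jT [c yc Bc]]] : exists j, j \in T /\ exists2 x, con (B i) (z i a) x & B j x.
  apply: contrapT => h2; apply: h => j x jT yx Bx; apply: h2; exists j; split=> //.
  by exists x.
have Bzia : ~ B i (z i a) by have [/(_ a)[]] := zT _ iT.
have ij : i != j.
  by apply/eqP => eij; move: Bc; rewrite -eij; apply: con_avoids yc Bzia.
have ji : j != i by rewrite eq_sym.
have [a' _ ha'] := @arm_choice Y j i (z j) ord0 ord_max (zT _ jT) ji isT.
have Bzja : ~ B j (z j a') by have [/(_ a')[]] := zT _ jT.
have sub x : con (B j) (z j a') x -> con (B i) (z i a) x.
  move=> yx; apply: con_trans yc _.
  apply: con_trans (con_sym (arm_root (zT _ jT) ji ha' Bc)) _.
  exact: con_switch yx.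
apply: (IH j a') => //; rewrite ltnS in mn; apply: leq_trans mn.
have subm k : m j a' k -> m i a k.
  by move=> /asboolP[x yx Bx]; apply/asboolP; exists x => //; apply: sub.
have mij : m i a j by apply/asboolP; exists c.
have mjj : ~~ m j a' j by apply/asboolP => -[x /con_avoids/(_ Bzja)].
have -> : count (m i a) T =
    (count (m j a') T + count (predD (m i a) (m j a')) T)%N.
  rewrite -count_predUI (@eq_count _ (predI _ _) pred0) ?count_pred0 ?addn0.
    by apply: eq_count => k /=; case: (boolP (m j a' k)) => //= /subm ->.
  by move=> k /=; case: (m j a' k).
rewrite -addn1 leq_add2l -has_count; apply/hasP; exists j => //=.
by rewrite mij mjj.
Qed.

Lemma ord3_others (a : 'I_3) : exists b c, [/\ b != a, c != a & b != c].
Proof.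
case: a => -[|[|[|//]]] h.
- by exists (inord 1), (inord 2); rewrite -!val_eqE /= !inordK.
- by exists (inord 0), (inord 2); rewrite -!val_eqE /= !inordK.
- by exists (inord 0), (inord 1); rewrite -!val_eqE /= !inordK.
Qed.

(* Induction on T: delete a set B_i with an arm that meets no other B_j, together with
   the vertices of Y on this arm. An arm of B_j that loses its vertex this way passes
   through B_i and can be redirected along another arm of B_i. *)
Lemma trifurcation_count (T : seq I) (Y : seq V) :
  uniq T -> (forall i, i \in T -> exists y, arms [set x | List.In x Y] i y) ->
  (size T <= size Y)%N.
Proof.
move eqn: (size T) => n.
elim: n T Y eqn => // n IH T Y sT uT TY.
have [z zT] : exists z : I -> 'I_3 -> V,
    forall i, i \in T -> arms [set x | List.In x Y] i (z i).
  suff /choice[z zT] : forall i, exists y : 'I_3 -> V,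
      i \in T -> arms [set x | List.In x Y] i y.
    by exists z.
  move=> i; case: (boolP (i \in T)) => [/TY[y yi]|_]; first by exists y.
  by case: T sT uT TY => // i0 T0 _ _ /(_ i0 (mem_head _ _))[y0 _]; exists y0.
case: T sT uT TY zT => // i0 T0 sT uT TY zT.
set T := i0 :: T0 in sT uT TY zT.
have [i [a [iT leaf]]] := leaf_exists ord0 zT (mem_head _ _ : i0 \in T).
pose Z x := `[< con (B i) (z i a) x >].
have [ziY ziN] := zT _ iT.
have [Yza Bza _] := ziY a.
pose Y' := [seq x <- Y | ~~ Z x].
have inY' x : List.In x Y' <-> List.In x Y /\ ~~ Z x by exact: List.filter_In.
have sY' : (size Y' < size Y)%N.
  rewrite size_filter -(count_predC Z Y) addnC -[ltnLHS]addn0 ltn_add2l -has_count.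
  have : Z (z i a) by apply/asboolP/con_refl.
  elim: (Y) Yza => //= y Y1 IH1 [->->//|/IH1 h /h ->]; exact: orbT.
apply: leq_trans sY'; rewrite ltnS; apply: (IH (rem i T)).
- by rewrite size_rem // sT.
- exact: rem_uniq.
move=> j; rewrite mem_rem_uniq // inE => /andP[ji jT].
have ij : i != j by rewrite eq_sym.
have [zjY zjN] := zT _ jT.
have Zj x : Z x -> con (B j) (z i a) x.
  move=> /asboolP zx; by apply: con_switch zx => x'; apply: leaf.
have [h|] := pselect (forall b, ~~ Z (z j b)).
  exists (z j); split=> // b; have [Yb Bb rb] := zjY b; split=> //.
  exact/inY'.
move=> /existsNP[b /negP/negPn Zb].
have [b1 [b2 [b1a b2a b12]]] := ord3_others a.
have [c cb cj] := arm_choice (zT _ iT) ij b12.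
have ca : c != a by case: cb => ->.
have [Yc Bc _] := ziY c.
have [_ _ [d Bd _]] := ziY a.
have zcb : con (B j) (z i c) (z j b).
  apply: con_trans (arm_root (zT _ iT) ij cj Bd) _; apply: con_trans (Zj _ Zb).
  apply/con_sym/(arm_root (zT _ iT) ij _ Bd) => x; exact: leaf.
have ZNc : ~~ Z (z i c).
  by apply/negP => /asboolP; apply: ziN; rewrite eq_sym.
exists (fun k => if k == b then z i c else z j k); split=> [k|k l kl].
  case: eqP => [_|/eqP kb].
    have [Yjb Bjb [e Be je]] := zjY b.
    split; [exact/inY'|exact: con_avoids (con_sym zcb) Bjb|exists e => //].
    by apply: con_trans je; apply: con_sub zcb => x.
  have [Yjk Bjk rjk] := zjY k; split=> //; apply/inY'; split=> //.
  apply/negP => /Zj zk; apply: (zjN _ _ kb).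
  exact: con_trans (con_sym zk) (Zj _ Zb).
case: eqP => [kb|/eqP kb]; case: eqP => [lb|/eqP lb]; last exact: zjN.
- by move: kl; rewrite kb lb eqxx.
- move=> h; apply: (zjN b l); first by rewrite eq_sym.
  exact: con_trans (con_sym zcb) h.
- move=> h; apply: (zjN k b) => //.
  exact: con_trans h zcb.
Qed.

End Trifurcations.
End Graph.

(** * Forms mod 2 and interfaces on the grid *)

Fixpoint sum_up (f : int -> bool) (n : nat) : bool :=
  if n is n'.+1 then sum_up f n' (+) f n'%:Z else false.
Fixpoint sum_down (f : int -> bool) (n : nat) : bool :=
  if n is n'.+1 then sum_down f n' (+) f (- n%:Z) else false.
Definition primitive (f : int -> bool) (n : int) : bool :=
  match n with Posz n => sum_up f n | Negz n => sum_down f n.+1 end.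

Lemma primitiveN f n : primitive f (- n%:Z) = sum_down f n.
Proof. by case: n => [|n]; rewrite ?oppr0 // -NegzE. Qed.

Lemma primitiveS f n : primitive f (n + 1) = primitive f n (+) f n.
Proof.
case: n => n; first by rewrite -PoszD addn1.
rewrite NegzE (_ : - n.+1%:Z + 1 = - n%:Z); last by lia.
by rewrite !primitiveN /= addbK.
Qed.

Lemma int_ind_step (P : int -> Prop) :
  P 0 -> (forall n, P n <-> P (n + 1)) -> forall n, P n.
Proof.
move=> P0 PS [] n; [|rewrite NegzE; move: n.+1 => {}n]; elim: n => // n IH.
  by rewrite -addn1 PoszD; apply: (PS n).1.
by apply: (PS _).2; rewrite (_ : - n.+1%:Z + 1 = - n%:Z) //; lia.
Qed.

Lemma nn_sym u v : nn u v -> nn v u.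
Proof.
by case: u v => x y [x' y'] [|[|[|]]] [-> ->]; rewrite /nn /= !(addrK, subrK); auto.
Qed.

Lemma Z2_ind (P : Z2 -> Prop) : P (0, 0) ->
  (forall u v, nn u v -> P u -> P v) -> forall u, P u.
Proof.
move=> P0 PS [x y].
elim/int_ind_step: y => [|n].
  elim/int_ind_step: x => // n; split; apply: PS.
    by left.
  by apply: nn_sym; left.
split; apply: PS.
  by right; right; left.
by apply: nn_sym; right; right; left.
Qed.

Definition potential (a : Z2 -> Z2 -> bool) (u : Z2) : bool :=
  primitive (fun i => a (i, 0) (i + 1, 0)) u.1 (+)
  primitive (fun j => a (u.1, j) (u.1, j + 1)) u.2.

Definition closed_form (a : Z2 -> Z2 -> bool) := forall x y : int,
  a (x, y) (x + 1, y) (+) a (x + 1, y) (x + 1, y + 1) =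
  a (x, y) (x, y + 1) (+) a (x, y + 1) (x + 1, y + 1).

Lemma nn_edge (P : Z2 -> Z2 -> Prop) : (forall u v, nn u v -> P u v -> P v u) ->
  (forall x y, P (x, y) (x + 1, y)) -> (forall x y, P (x, y) (x, y + 1)) ->
  forall u v, nn u v -> P u v.
Proof.
move=> Psym Ph Pv [x y] [x' y'] [|[|[|]]] [-> ->] //.
  apply: Psym; first by left; rewrite /= subrK.
  by have := Ph (x - 1) y; rewrite subrK.
apply: Psym; first by right; right; left; rewrite /= subrK.
by have := Pv x (y - 1); rewrite subrK.
Qed.

Lemma potential_nn a : (forall u v, nn u v -> a u v = a v u) -> closed_form a ->
  forall u v, nn u v -> potential a u (+) potential a v = a u v.
Proof.
move=> a_sym a_cl; apply: nn_edge => [u v uv h|x y|x y].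
- by rewrite addbC h a_sym.
- elim/int_ind_step: y => [|y].
    by rewrite /potential /= primitiveS !addbF addbA addbb.
  have := a_cl x y.
  rewrite /potential /= !primitiveS.
  move: (primitive (fun i => a (i, 0) _) x) (primitive (fun j => a (x, j) _) y).
  move: (primitive (fun j => a (x + 1, j) _) y) (a (x, 0) _) (a (x, y) (x + 1, y)).
  move: (a (x + 1, y) _) (a (x, y) _) (a (x, y + 1) _).
  by do 8!case.
- rewrite /potential /= primitiveS.
  by case: (primitive _ _); case: (primitive _ _); case: (a _ _).
Qed.

Definition same (s : Z2 -> bool) u v := nn u v /\ s u = s v.

Lemma same_sym s u v : same s u v -> same s v u.
Proof. by move=> [/nn_sym vu suv]; split. Qed.

Definition cluster s u := [set v | con (same s) set0 u v].

Definition const_on_face (s : Z2 -> bool) (x y : int) : bool :=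
  [&& s (x + 1, y) == s (x, y), s (x, y + 1) == s (x, y) &
      s (x + 1, y + 1) == s (x, y)].

Definition compat (s t : Z2 -> bool) :=
  forall x y, const_on_face s x y || const_on_face t x y.

Lemma compatC s t : compat s t -> compat t s.
Proof. by move=> h x y; rewrite orbC. Qed.

Lemma compat_nn s t u v : compat s t -> nn u v -> s u != s v -> t u = t v.
Proof.
move=> st; move: u v; apply: nn_edge => [u v _ h|x y|x y].
- by rewrite eq_sym => /h.
- by have /orP[/and3P[/eqP->]|/and3P[/eqP->]] := st x y; rewrite ?eqxx.
- by have /orP[/and3P[_ /eqP->]|/and3P[_ /eqP->]] := st x y; rewrite ?eqxx.
Qed.

Lemma con_sign s B u v : con (same s) B u v -> s u = s v.
Proof. by elim=> [x y [[]]|//|x y z _ -> _ ->]. Qed.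

(* Let X be the component of z outside C. Across the edges leaving X the spin s jumps,
   so t does not; hence those with t = true form a closed 1-form mod 2, whose potential
   is constant on C and on X. *)
Lemma interface_const s t v0 z v v' y y' : compat s t ->
  cluster s v0 v -> cluster s v0 v' -> ~ cluster s v0 y -> ~ cluster s v0 y' ->
  nn v y -> nn v' y' ->
  con nn (cluster s v0) y z -> con nn (cluster s v0) y' z ->
  t v = t v'.
Proof.
set C := cluster s v0 => st Cv Cv' Cy Cy' vy vy' yz yz'.
have Cz := con_avoids yz Cy.
pose X x := `[< con nn C x z >].
have XC x : X x -> ~ C x.
  move=> /asboolP /(con_sym nn_sym) zx; exact: con_avoids zx Cz.
have XV u u' : nn u u' -> X u -> ~~ X u' -> C u'.
  move=> uu' Xu; apply: contraNP => Cu'; apply/asboolP.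
  apply: con_trans (asboolW Xu); apply: con_step => //; first exact: nn_sym.
  exact: XC.
have Xs u u' : nn u u' -> X u != X u' -> s u != s u'.
  wlog Xu : u u' / X u.
    move=> h uu' XX; have [Xu|Xu] := boolP (X u); first exact: h.
    rewrite eq_sym; apply: h (nn_sym uu') _; last by rewrite eq_sym.
    by move: XX; rewrite (negbTE Xu); case: (X u').
  move=> uu'; rewrite Xu /= => Xu'; apply/eqP => suu'.
  apply: (XC u Xu); apply: con_trans (XV _ _ uu' Xu _) _; first by case: (X u') Xu'.
  by apply: con_step => //; split=> //; exact: nn_sym.
pose a u u' := (X u (+) X u') && t u.
have a_sym u u' : nn u u' -> a u u' = a u' u.
  move=> uu'; rewrite /a addbC; have [Xuu'|] := eqVneq (X u) (X u').
    by rewrite Xuu' addbb.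
  by move=> /(Xs _ _ uu')/(compat_nn st uu') ->.
have a_cl : closed_form a.
  move=> x' y''.
  have /orP[] := st x' y'' => /and3P[/eqP s1 /eqP s2 /eqP s3].
    have Xe u u' : nn u u' -> s u = s u' -> X u = X u'.
      by move=> uu' suu'; apply/eqP; apply: contraTT isT => /(Xs _ _ uu'); rewrite suu' eqxx.
    have e1 : X (x' + 1, y'') = X (x', y'') by apply/esym/Xe => //; left.
    have e2 : X (x', y'' + 1) = X (x', y'') by apply/esym/Xe => //; right; right; left.
    have e3 : X (x' + 1, y'' + 1) = X (x', y'' + 1).
      by apply/esym/Xe; [left|rewrite s2 s3].
    by rewrite /a e3 e1 e2 !addbb.
  rewrite /a s1 s2; case: (t _); rewrite ?andbF // !andbT.
  by case: (X _); case: (X _); case: (X _); case: (X _).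
have g_a := potential_nn a_sym a_cl; set g := potential a in g_a.
have g_eq u u' : nn u u' -> X u = X u' -> g u = g u'.
  move=> uu' Xuu'; move: (g_a _ _ uu'); rewrite /a Xuu' addbb /=.
  by case: (g u); case: (g u').
have gX x : con nn C x z -> g x = g z.
  move=> /(con_sym nn_sym)/clos_rt_rtn1_iff; elim=> // u u' [uu' Cu Cu'] zu <-.
  have zu' := clos_rtn1_rt _ _ _ _ zu.
  apply/esym/g_eq => //; transitivity true; last apply/esym.
    by apply/asboolP/(con_sym nn_sym).
  by apply/asboolP/(con_sym nn_sym)/(con_trans zu')/con_step.
have gC x : C x -> g x = g v0.
  move=> /clos_rt_rtn1_iff; elim=> // u u' [[uu' suu'] _ _] v0u <-.
  have Cu : C u := clos_rtn1_rt _ _ _ _ v0u.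
  have Cu' : C u' by apply: con_trans Cu _; apply: con_step.
  apply/esym/g_eq => //; transitivity false; last apply/esym.
    by apply/negbTE; apply: contraPN Cu => /XC.
  by apply/negbTE; apply: contraPN Cu' => /XC.
have t_g x x' : C x -> nn x x' -> con nn C x' z -> t x = g v0 (+) g z.
  move=> Cx xx' x'z; rewrite -(gX _ x'z) -(gC _ Cx) g_a // /a (_ : X x' = true).
    by rewrite (_ : X x = false) //; apply/negbTE; apply: contraPN Cx => /XC.
  exact/asboolP.
by rewrite (t_g _ _ Cv vy yz) (t_g _ _ Cv' vy' yz').
Qed.

Definition unbounded (r : Z2 -> Z2 -> Prop) (B : set Z2) (u : Z2) :=
  forall l : seq Z2, exists2 v, con r B u v & v \notin l.

Lemma unbounded_con r B u v : (forall u v, r u v -> r v u) ->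
  con r B u v -> unbounded r B u -> unbounded r B v.
Proof.
move=> r_sym uv ui l; have [w uw wl] := ui l; exists w => //.
exact: con_trans (con_sym r_sym uv) uw.
Qed.

Lemma unbounded_sub r B B' u : B' `<=` B -> unbounded r B u -> unbounded r B' u.
Proof. by move=> BB' ui l; have [w uw wl] := ui l; exists w => //; apply: con_sub uw. Qed.

Definition nbrs (u : Z2) : seq Z2 :=
  [:: (u.1 + 1, u.2); (u.1 - 1, u.2); (u.1, u.2 + 1); (u.1, u.2 - 1)].

Lemma nn_nbrs u v : nn u v -> v \in nbrs u.
Proof. by rewrite !inE; case=> [|[|[|]]] ->; rewrite eqxx ?orbT. Qed.

Lemma unbounded_escape r (b : seq Z2) u : (forall u v, r u v -> r v u) ->
  (forall u v, r u v -> nn u v) -> unbounded r set0 u ->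
  exists x, [/\ con r set0 u x, x \notin b & unbounded r [set` b] x].
Proof.
move=> r_sym r_nn ui; apply: contrapT => h.
have [l hl] : exists l : Z2 -> seq Z2, forall x, con r set0 u x -> x \notin b ->
    forall v, con r [set` b] x v -> v \in l x.
  suff /choice[l hl] : forall x, exists l : seq Z2, con r set0 u x -> x \notin b ->
      forall v, con r [set` b] x v -> v \in l.
    by exists l.
  move=> x; have [ux|ux] := pselect (con r set0 u x); last by exists [::].
  have [xb|xb] := boolP (x \in b); first by exists [::].
  apply: contrapT => h'; apply: h; exists x; split=> // l.
  apply: contrapT => h''; apply: h'; exists l => _ _ v xv.
  by apply/negPn/negP => vl; apply: h''; exists v.
have [v uv] := ui (b ++ l u ++ flatten [seq l y | y <- flatten [seq nbrs x | x <- b]]).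
rewrite !mem_cat !negb_or => /and3P[vb /negP vlu /negP]; apply.
have [[x xb vx]|vN] := pselect (exists2 x, x \in b & con r set0 v x).
  have [|y [c [vy yc cb]]] := con_hit vx _ (xb : [set` b] x); first exact/negP.
  apply/flattenP; exists (l y).
    apply/map_f/flattenP; exists (nbrs c); first exact: map_f.
    exact/nn_nbrs/r_nn/r_sym.
  have uy : con r set0 u y by apply: con_trans uv _; apply: con_sub vy.
  apply: hl => //; last exact: con_sym.
  by apply/negP; apply: con_avoids vy _; apply/negP.
case: vlu; apply: hl => //; first exact: con_refl.
  apply/negP => ub; apply: vN; exists u => //; exact: con_sym.
apply: (con_sym r_sym); apply: (con_switch _ (con_sym r_sym uv)).
by move=> x vx xb; apply: vN; exists x.
Qed.

Lemma same_nn s u v : same s u v -> nn u v. Proof. by case. Qed.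

Definition infinite_in s u := unbounded (same s) set0 u.

(* v lies on the part of the boundary of its infinite cluster that faces another
   infinite cluster. *)
Definition facing s v := infinite_in s v /\
  exists y z, [/\ nn v y, ~ cluster s v y, con nn (cluster s v) y z & infinite_in s z].

(* When no sign has three infinite clusters, this says that the sign of u has strictly
   more infinite clusters than the other one. *)
Definition dominant s u := infinite_in s u /\
  ((forall v, infinite_in s v -> s v = s u) \/
   ((exists v, [/\ infinite_in s v, s v = s u & ~ cluster s u v]) /\
    (forall v v', infinite_in s v -> infinite_in s v' ->
      s v <> s u -> s v' <> s u -> cluster s v v'))).

Definition two_alike s := exists u v,
  [/\ infinite_in s u, infinite_in s v, s u = s v & ~ cluster s u v].

Definition three_alike s := exists x : 'I_3 -> Z2,
  [/\ forall a, infinite_in s (x a), forall a b, s (x a) = s (x b) &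
      forall a b, a != b -> ~ cluster s (x a) (x b)].

Lemma cluster_sym s u v : cluster s u v -> cluster s v u.
Proof. exact/con_sym/same_sym. Qed.

Lemma cluster_trans s u v w : cluster s u v -> cluster s v w -> cluster s u w.
Proof. exact: con_trans. Qed.

Lemma dominant_sign s u u' : dominant s u -> dominant s u' -> s u = s u'.
Proof.
move=> [ui hu] [u'i hu']; apply: contrapT => uu'.
case: hu => [/(_ _ u'i)/esym //|[[v [vi vu uv]] hu]].
case: hu' => [/(_ _ ui) //|[[v' [v'i vu' uv']] hu']].
by apply: uv; apply: hu' => //; rewrite vu.
Qed.

Lemma con_nn u v : con nn set0 u v.
Proof.
have h w : con nn set0 (0, 0) w.
  elim/Z2_ind: w => [|w w' ww' h]; first exact: con_refl.
  exact: con_trans h (con_step _ _ _).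
exact: con_trans (con_sym nn_sym (h u)) (h v).
Qed.

Lemma facing_exists s u z : infinite_in s u -> infinite_in s z -> ~ cluster s u z ->
  exists v, facing s v.
Proof.
move=> ui zi uz.
have [|y [c [zy yc uc]]] := con_hit (B := cluster s u) (con_nn z u) uz; first exact: con_refl.
have cE : cluster s c = cluster s u.
  apply/seteqP; split=> x; first exact: cluster_trans.
  exact/cluster_trans/cluster_sym.
exists c; split; first exact: (unbounded_con (@same_sym s) uc ui).
exists y, z; rewrite cE; split=> //; first exact: nn_sym.
  exact: con_avoids zy uz.
exact: (con_sym nn_sym zy).
Qed.

Section OneEach.
Variables (s t : Z2 -> bool).
Hypothesis st : compat s t.
Hypothesis s_dom : forall u, ~ dominant s u.
Hypothesis s_two : ~ two_alike s.

Lemma infinite_cluster u v : infinite_in s u -> infinite_in s v -> s u = s v -> cluster s u v.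
Proof. by move=> ui vi uv; apply: contrapT => h; apply: s_two; exists u, v. Qed.

Lemma facing_infinite u : infinite_in s u -> exists v, facing s v.
Proof.
move=> ui; apply: contrapT => h; apply: (s_dom (u := u)); split=> //; left=> z zi.
apply: contrapT => zu; apply: h; apply: facing_exists ui zi _.
by move=> /con_sign/esym.
Qed.

Lemma facing_const v v' : facing s v -> facing s v' -> s v = s v' -> t v = t v'.
Proof.
move=> [vi [y [z [vy vNy yz zi]]]] [v'i [y' [z' [v'y' vNy' yz' zi']]]] ss.
have vv' := infinite_cluster vi v'i ss.
have E : cluster s v' = cluster s v.
  apply/seteqP; split=> x; first exact: cluster_trans.
  exact/cluster_trans/cluster_sym.
rewrite E in vNy' yz'.
have opp w x : infinite_in s w -> ~ cluster s v x -> con nn (cluster s v) x w -> s w <> s v.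
  move=> wi vx xw /esym/(infinite_cluster vi wi); exact: con_avoids xw vx.
have zz' : cluster s z z'.
  apply: infinite_cluster => //; have := opp _ _ zi vNy yz; have := opp _ _ zi' vNy' yz'.
  by case: (s z); case: (s z'); case: (s v).
apply: (interface_const st (con_refl _ _ _) vv' vNy vNy' vy v'y' yz).
apply: con_trans yz' _; apply: (con_sym nn_sym).
have vz := con_avoids yz vNy.
elim: zz' vz => [x x' [[xx' sxx'] _ _] vx|x _|x x' x'' xx' IH1 _ IH2 vx].
- apply: con_step => // vx'; apply: vx; apply: cluster_trans vx' _.
  by apply: cluster_sym; apply: con_step.
- exact: con_refl.
- apply: con_trans (IH1 vx) (IH2 _) => vx'; apply: vx.
  exact: cluster_trans vx' (cluster_sym xx').
Qed.

End OneEach.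

Definition well_behaved s := ~ (exists u, dominant s u) /\ ~ two_alike s.

Lemma facing_uniform s t : compat s t -> well_behaved s -> (exists v, facing s v) ->
  ~ (forall v v', facing s v -> facing s v' -> s v (+) t v = s v' (+) t v') ->
  forall v v', facing s v -> facing s v' -> t v = t v'.
Proof.
move=> st [nd n2] [v0 Fv0] nc.
have tc := facing_const st n2.
have [x [y [Fx Fy sxy txy]]] : exists x y, [/\ facing s x, facing s y, s x <> s y & t x = t y].
  apply: contrapT => h; apply: nc => v v' Fv Fv'.
  have [svv'|svv'] := eqVneq (s v) (s v'); first by rewrite svv' (tc v v').
  have tvv' : t v <> t v' by move=> tvv'; apply: h; exists v, v'; split=> //; apply/eqP.
  by move: svv' tvv'; case: (s v); case: (s v'); case: (t v); case: (t v').
have tx v : facing s v -> t v = t x.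
  move=> Fv; have [svx|svx] := eqVneq (s v) (s x); first exact: tc.
  rewrite txy; apply: tc => //.
  by move: svx sxy; case: (s v); case: (s x); case: (s y).
by move=> v v' /tx -> /tx ->.
Qed.

(** * Filling a finite set *)

Definition fill (b : seq Z2) (c : bool) (s : Z2 -> bool) (u : Z2) :=
  if u \in b then c else s u.

Definition connected_seq (b : seq Z2) :=
  forall r : Z2 -> Z2 -> Prop, (forall u v, r u v -> r v u) ->
  (forall u v, nn u v -> u \in b -> v \in b -> r u v) ->
  forall u v, u \in b -> v \in b -> con r (~` [set` b]) u v.

Definition trifurcation (b : seq Z2) s :=
  (forall u v, u \in b -> v \in b -> s u = s v) /\
  exists x : 'I_3 -> Z2,
  [/\ forall a, x a \notin b /\ unbounded (same s) [set` b] (x a),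
      forall a, exists2 u, u \in b & cluster s (x a) u &
      forall a a', a != a' -> ~ con (same s) [set` b] (x a) (x a')].

Section Fill.
Variables (b : seq Z2) (c : bool) (s : Z2 -> bool).
Let s' := fill b c s.

Lemma con_fill u v : con (same s) [set` b] u v <-> con (same s') [set` b] u v.
Proof.
split; elim=> [x y [[xy sxy] xb yb]|x|x y z _ xy _ yz].
- apply: con_step => //; split=> //; rewrite /s' /fill.
  by rewrite (negbTE (introN idP xb)) (negbTE (introN idP yb)).
- exact: con_refl.
- exact: con_trans xy yz.
- apply: con_step => //; split=> //; move: sxy; rewrite /s' /fill.
  by rewrite (negbTE (introN idP xb)) (negbTE (introN idP yb)).
- exact: con_refl.
- exact: con_trans xy yz.
Qed.

Lemma fill_out u : u \notin b -> s' u = s u.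
Proof. by rewrite /s' /fill => /negbTE ->. Qed.

Lemma fill_in u : u \in b -> s' u = c.
Proof. by rewrite /s' /fill => ->. Qed.

Lemma unbounded_fill u : unbounded (same s) [set` b] u -> unbounded (same s') [set` b] u.
Proof. by move=> ui l; have [v /con_fill uv vl] := ui l; exists v. Qed.

Lemma reach_fill u v : cluster s u v -> s u = c -> u \notin b -> v \in b ->
  exists2 w, w \in b & cluster s' u w.
Proof.
move=> uv su ub vb.
have [|x [w [ux xw wb]]] := con_hit uv _ (vb : [set` b] v); first exact/negP.
exists w => //; apply: con_trans (con_sub (@sub0set _ _) ((con_fill _ _).1 ux)) _.
have xb : x \notin b by apply/negP; apply: con_avoids ux _; apply/negP.
apply: con_step => //; split; first by case: xw.
by rewrite (fill_in wb) fill_out // -su (con_sign ux).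
Qed.

Lemma cluster_fill_opp u v : s' u = ~~ c -> cluster s' u v -> con (same s) [set` b] u v.
Proof.
move=> su uv; apply/con_fill; have sN x : s' x = ~~ c -> ~ [set` b] x.
  by move=> /[swap] /fill_in ->; case: (c).
apply: con_switch uv.
by move=> x /con_sign ux; apply: sN; rewrite -ux.
Qed.

Lemma fill_trifurcation x : (forall a, x a \in b) ->
  (forall a, infinite_in s (x a)) -> (forall a, s (x a) = c) ->
  (forall a a' : 'I_3, a != a' -> ~ cluster s (x a) (x a')) -> trifurcation b s'.
Proof.
move=> xb xi xc xN; split=> [u v ub vb|]; first by rewrite !fill_in.
have /choice[y yP] a := unbounded_escape b (@same_sym s) (@same_nn s) (xi a).
exists y; split=> [a|a|a a' aa' /con_fill yy].
- by have [xy yb yi] := yP a; split=> //; apply: unbounded_fill.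
- have [xy yb yi] := yP a; apply: (reach_fill (con_sym (@same_sym s) xy)) => //.
  by rewrite -(con_sign xy).
- apply: (xN _ _ aa'); have [xy _ _] := yP a; have [xy' _ _] := yP a'.
  apply: con_trans xy _; apply: con_trans (con_sub (@sub0set _ _) yy) _.
  exact: (con_sym (@same_sym s) xy').
Qed.

Lemma fill_dominant u v : connected_seq b -> u \in b -> v \in b ->
  infinite_in s u -> infinite_in s v -> s u = c -> s v = c -> ~ cluster s u v ->
  ~ three_alike s -> (forall x, ~ dominant s x) -> exists x, dominant s' x.
Proof.
move=> b_conn ub vb ui vi uc vc uv s3 s_dom.
have [y [y' [yi yi' yc yc' yy']]] : exists y y', [/\ infinite_in s y, infinite_in s y',
    s y = ~~ c, s y' = ~~ c & ~ cluster s y y'].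
  apply: contrapT => h; apply: (s_dom u); split=> //; right; split.
    by exists v; rewrite uc vc.
  move=> y y' yi yi' yc yc'; apply: contrapT => yy'; apply: h; exists y, y'; split=> //.
    by move: yc; rewrite uc; case: (s y); case: (c).
  by move: yc'; rewrite uc; case: (s y'); case: (c).
have esc z : infinite_in s z -> s z = ~~ c ->
    exists z', [/\ cluster s z z', infinite_in s' z' & s' z' = ~~ c].
  move=> zi zc; have [z' [zz' zb' zi']] := unbounded_escape b (@same_sym s) (@same_nn s) zi.
  exists z'; split=> //; last by rewrite fill_out // -(con_sign zz').
  by apply: unbounded_sub (unbounded_fill zi').
have [x [yx xi xc]] := esc y yi yc.
have [x' [yx' xi' xc']] := esc y' yi' yc'.
exists x; split=> //; right; split.
  exists x'; split=> //; first by rewrite xc xc'.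
  move=> /(cluster_fill_opp xc) xx'; apply: yy'; apply: cluster_trans yx _.
  apply: cluster_trans (cluster_sym yx'); exact: con_sub xx'.
have toB w : infinite_in s' w -> s' w <> s' x -> exists2 w', w' \in b & cluster s' w w'.
  move=> wi wx; have wc : s' w = c by move: wx; rewrite xc; case: (s' w); case: (c).
  have [wb|wb] := boolP (w \in b); first by exists w => //; exact: con_refl.
  have swc : s w = c by rewrite -fill_out.
  have [[w' wb' ww']|h] := pselect (exists2 w', w' \in b & cluster s w w').
    exact: reach_fill ww' swc wb wb'.
  have [//|h'] := pselect (exists2 w', w' \in b & cluster s' w w').
  have wis : infinite_in s w.
    move=> l; have [z wz zl] := wi l; exists z => //.
    apply: con_sub (sub0set [set` b]) _; apply/con_fill.
    apply: con_switch wz.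
    by move=> z' wz' zb'; apply: h'; exists z'.
  case: s3; pose f (a : 'I_3) := if a == ord0 then u else if a == ord_max then v else w.
  have fc a : s (f a) = c by rewrite /f; case: ifP => // _; case: ifP.
  exists f; split=> [a|a a'|]; first by rewrite /f; case: ifP => // _; case: ifP.
    by rewrite !fc.
  have uw : ~ cluster s u w by move=> /cluster_sym wu; apply: h; exists u.
  have vw : ~ cluster s v w by move=> /cluster_sym wv; apply: h; exists v.
  move=> a a'; rewrite /f; have := ltn_ord a; have := ltn_ord a'.
  rewrite -!val_eqE /=.
  case: (val a) (val a') => [|[|[|//]]] [|[|[|//]]] //= _ _ _ //;
    by move=> /cluster_sym.
move=> w w' wi wi' wx wx'.
have [z zb wz] := toB w wi wx; have [z' zb' wz'] := toB w' wi' wx'.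
apply: cluster_trans wz _; apply: cluster_trans (cluster_sym wz').
apply: con_sub (sub0set (~` [set` b])) _; apply: b_conn => //; first exact: same_sym.
by move=> p q pq pb qb; split=> //; rewrite !fill_in.
Qed.

End Fill.

(** * Tiles and translations *)

(* The vertical offset 1 makes tiles with even corner and even side unions of the
   2x2 blocks of sites inside the faces of L1. *)
Definition tile (a : Z2) (L : nat) : seq Z2 :=
  [seq (a.1 + i%:Z, a.2 + 1 + j%:Z) | i <- iota 0 L, j <- iota 0 L].

Lemma mem_tile a L u : (u \in tile a L) =
  [&& a.1 <= u.1, u.1 < a.1 + L%:Z, a.2 + 1 <= u.2 & u.2 < a.2 + 1 + L%:Z].
Proof.
apply/allpairsP/idP => [[[i j] /= []]|].
  rewrite !mem_iota => iL jL ->; apply/and4P; split; rewrite /=; lia.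
case: u => x y /and4P[/= ax xa ay ya]; exists (absz (x - a.1)%R, absz (y - a.2 - 1)%R).
by rewrite !mem_iota /=; split; [lia|lia|congr (_, _); lia].
Qed.

Lemma tile_connected a L : connected_seq (tile a L).
Proof.
move=> r r_sym r_nn.
suff h u : u \in tile a L -> con r (~` [set` tile a L]) (a.1, a.2 + 1) u.
  by move=> u v /h ua /h; apply: con_trans (con_sym r_sym ua).
have step x v w : con r (~` [set` tile a L]) x v -> nn v w ->
    v \in tile a L -> w \in tile a L -> con r (~` [set` tile a L]) x w.
  move=> xv vw va wa; apply: con_trans xv _.
  by apply: con_step; [exact: r_nn|move=> /(_ va)|move=> /(_ wa)].
move=> /allpairsP[[i j] /= []]; rewrite !mem_iota /= !add0n => iL jL ->.
elim: j jL => [|j IH] jL; last first.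
  apply: (step _ (a.1 + i%:Z, a.2 + 1 + j%:Z)); first by apply: IH; lia.
  - by right; right; left; congr (_, _) => /=; lia.
  - by rewrite mem_tile /=; lia.
  - by rewrite mem_tile /=; lia.
rewrite addr0; elim: i iL => [|i IH] iL; first by rewrite addr0; exact: con_refl.
apply: (step _ (a.1 + i%:Z, a.2 + 1)); first by apply: IH; lia.
- by left; congr (_, _) => /=; lia.
- by rewrite mem_tile /=; lia.
- by rewrite mem_tile /=; lia.
Qed.

Lemma tile_cover (x : seq Z2) : exists n : nat,
  {subset x <= tile (- (2 * n%:Z), - (2 * n%:Z)) (2 * n).*2}.
Proof.
elim: x => [|u x [n IH]]; first by exists 0%N.
exists (n + (absz u.1 + absz u.2).+1)%N => v; rewrite inE mem_tile /= => /orP[/eqP->|/IH].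
  by apply/and4P; split; lia.
by rewrite mem_tile /= => /and4P[? ? ? ?]; apply/and4P; split; lia.
Qed.

Lemma con_exit (V : Type) (r : V -> V -> Prop) B (D : set V) x z :
  con r B x z -> D x -> ~ D z -> exists y w, [/\ con r B x y, D w, r w y & ~ D y].
Proof.
move=> /clos_rt_rt1n_iff; elim=> [//|u v w [uv uB vB] _ IH Du Dw].
have uvB : con r B u v by exact: con_step.
have [Dv|Dv] := pselect (D v); last by exists v, u.
by have [y [w' [vy ? ? ?]]] := IH Dv Dw; exists y, w'; split=> //; apply: con_trans vy.
Qed.

Definition outer_ring (N : nat) : seq Z2 :=
  [seq (-1, i%:Z + 1) | i <- iota 0 N] ++ [seq (N%:Z, i%:Z + 1) | i <- iota 0 N] ++
  [seq (i%:Z, 0) | i <- iota 0 N] ++ [seq (i%:Z, N%:Z + 1) | i <- iota 0 N].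

Lemma mem_outer_ring N u v : u \in tile (0, 0) N -> nn u v -> v \notin tile (0, 0) N ->
  v \in outer_ring N.
Proof.
rewrite !mem_tile !mem_cat /= => uN uv vN.
have [k1 [k2 [k1N k2N e]]] : exists k1 k2 : nat,
    [/\ (k1 < N)%N, (k2 < N)%N & u = (k1%:Z, k2%:Z + 1)].
  case: u uN {uv} => x y /= h; exists (absz x), (absz (y - 1)%R).
  by split; [lia|lia|congr (_, _); lia].
move: uv vN; rewrite e => -[|[|[|]]] -> /= vN; apply/or4P.
- apply: Or42; apply/mapP; exists k2; first by rewrite mem_iota.
  by congr (_, _); lia.
- apply: Or41; apply/mapP; exists k2; first by rewrite mem_iota.
  by congr (_, _); lia.
- apply: Or44; apply/mapP; exists k1; first by rewrite mem_iota.
  by congr (_, _); lia.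
- apply: Or43; apply/mapP; exists k1; first by rewrite mem_iota.
  by congr (_, _); lia.
Qed.

Definition tile_at (L : nat) (i : nat * nat) := tile ((L * i.1)%N%:Z, (L * i.2)%N%:Z) L.

Lemma tile_at_sub L M i : (i.1 < M)%N -> (i.2 < M)%N ->
  {subset tile_at L i <= tile (0, 0) (M * L)}.
Proof. by case: i => i j /= iM jM u; rewrite !mem_tile /=; nia. Qed.

Lemma tile_at_disj L i j x : i != j -> x \in tile_at L i -> x \notin tile_at L j.
Proof.
move=> ij; apply: contraTN; rewrite !mem_tile /=; apply: contraTN => xi.
apply/negP => xj; case/negP: ij; case: i j xi xj => [i1 i2] [j1 j2] /= xi xj.
by apply/eqP; congr (_, _); nia.
Qed.

Lemma trifurcation_tiles s L M :
  (count (fun i => `[<trifurcation (tile_at L i) s>])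
     [seq (i, j) | i <- iota 0 M, j <- iota 0 M] <= 4 * (M * L))%N.
Proof.
rewrite -size_filter; set T := seq.filter _ _.
have -> : (4 * (M * L))%N = size (outer_ring (M * L)).
  by rewrite !size_cat !size_map !size_iota; lia.
have TP i : i \in T -> [/\ trifurcation (tile_at L i) s, (i.1 < M)%N & (i.2 < M)%N].
  rewrite mem_filter => /andP[/asboolP tri /allpairsP[[i1 i2] /= []]].
  by rewrite !mem_iota => i1M i2M ie; move: tri; rewrite ie; split.
pose I := seq_sub T.
have Bd (i j : I) x : i != j -> [set` tile_at L (val i)] x -> ~ [set` tile_at L (val j)] x.
  by move=> ij xi; apply/negP; apply: tile_at_disj xi.
have Bc (i : I) x y : [set` tile_at L (val i)] x -> [set` tile_at L (val i)] y ->
    con (same s) (~` [set` tile_at L (val i)]) x y.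
  move=> xi yi; have [[sc _] _ _] := TP _ (valP i).
  apply: tile_connected => //; first exact: same_sym.
  by move=> u v uv ui vi; split=> //; apply: sc.
have uT : uniq T.
  by apply/filter_uniq/allpairs_uniq; rewrite ?iota_uniq // => -[? ?] [? ?].
rewrite -(card_seq_sub uT) cardE.
apply: (trifurcation_count (@same_sym s) Bc Bd); first exact: enum_uniq.
move=> i _; have [[_ [x [xi xr xN]]] i1 i2] := TP _ (valP i).
set b := tile_at L (val i) in xi xr xN.
have bsub : {subset b <= tile (0, 0) (M * L)} := tile_at_sub i1 i2.
have /choice[y yP] a : exists y, y \in outer_ring (M * L) /\ con (same s) [set` b] (x a) y.
  have [xb xinf] := xi a; have [u ub xu] := xr a.
  have [|y [c [xy yc cb]]] := con_hit xu _ (ub : [set` b] u); first exact/negP.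
  have [z yz zN] := unbounded_con (@same_sym s) xy xinf (tile (0, 0) (M * L)).
  have [yN|yN] := boolP (y \in tile (0, 0) (M * L)).
    have [|w [v [yw vN [vw _] wN]]] := con_exit yz (yN : [set` _] y); first exact/negP.
    exists w; split; last exact: con_trans xy yw.
    by apply: mem_outer_ring vN vw _; apply/negP.
  exists y; split=> //; apply: (mem_outer_ring (u := c)) yN; first exact: bsub.
  by case: yc => /nn_sym.
exists y; split=> [a|a a' aa' yy].
  have [ya xy] := yP a; have [xb _] := xi a; have [u ub xu] := xr a.
  split; first by elim: (outer_ring _) ya => //= v l IH; rewrite inE => /orP[/eqP->|/IH]; auto.
    by apply: con_avoids xy _; apply/negP.
  exists u => //; apply: con_trans xu; apply: (con_sym (@same_sym s)).
  exact: con_sub (sub0set _) xy.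
apply: (xN _ _ aa'); have [_ xy] := yP a; have [_ xy'] := yP a'.
exact: con_trans xy (con_trans yy (con_sym (@same_sym s) xy')).
Qed.

Definition shift (a u : Z2) : Z2 := (u.1 + a.1, u.2 + a.2).

Lemma shiftK a : cancel (shift a) (shift (- a)).
Proof. by case: a => a1 a2 [x y]; rewrite /shift /= !addrK. Qed.

Lemma shiftNK a : cancel (shift (- a)) (shift a).
Proof. by case: a => a1 a2 [x y]; rewrite /shift /= !subrK. Qed.

Lemma nn_shift a u v : nn u v -> nn (shift a u) (shift a v).
Proof.
case: u v => x y [x' y'] /= [|[|[|]]] [-> ->]; [left|right;left|do 2!right;left|do 3!right];
  by rewrite /shift /= addrAC.
Qed.

(* Invariance under [sim] expresses at once translation covariance and blindness to a
   global sign. *)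
Definition sim a (s' s : Z2 -> bool) :=
  forall u v, (s' u == s' v) = (s (shift a u) == s (shift a v)).

Lemma sim_opp a s' s : sim a s' s -> sim (- a) s s'.
Proof. by move=> h u v; rewrite h !shiftNK. Qed.

Lemma shift0 u : shift 0 u = u.
Proof. by case: u => x y; rewrite /shift /= !addr0. Qed.

Lemma sim_refl s : sim 0 s s.
Proof. by move=> [x y] [x' y']; rewrite /shift /= !addr0. Qed.

Lemma sim_neg s' s : (forall u, s' u = ~~ s u) -> sim 0 s' s.
Proof.
by move=> h [x y] [x' y']; rewrite !h /shift /= !addr0; case: (s _); case: (s _).
Qed.

Lemma con_shift a (r r' : Z2 -> Z2 -> Prop) (B B' : set Z2) u v :
  (forall u v, r' u v -> r (shift a u) (shift a v)) ->
  (forall x, B (shift a x) -> B' x) ->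
  con r' B' u v -> con r B (shift a u) (shift a v).
Proof.
move=> rr BB; elim=> [x y [xy xB yB]|x|x y z _ xy _ yz].
- by apply: con_step; [exact: rr|move=> /BB|move=> /BB].
- exact: con_refl.
- exact: con_trans xy yz.
Qed.

Section Sim.
Variables (a : Z2) (s' s : Z2 -> bool).
Hypothesis ss : sim a s' s.

Lemma same_sim u v : same s' u v -> same s (shift a u) (shift a v).
Proof. by move=> [/(nn_shift a) uv /eqP]; rewrite ss => /eqP. Qed.

Lemma con_sim (B B' : set Z2) u v : (forall x, B (shift a x) -> B' x) ->
  con (same s') B' u v -> con (same s) B (shift a u) (shift a v).
Proof. by move=> BB; apply: con_shift => //; exact: same_sim. Qed.

Lemma cluster_sim u v : cluster s' u v -> cluster s (shift a u) (shift a v).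
Proof. exact: con_sim. Qed.

Lemma unbounded_sim (B B' : set Z2) u : (forall x, B (shift a x) -> B' x) ->
  unbounded (same s') B' u -> unbounded (same s) B (shift a u).
Proof.
move=> BB ui l; have [v uv vl] := ui (map (shift (- a)) l).
exists (shift a v); first exact: con_sim uv.
by apply: contra vl => /(map_f (shift (- a))); rewrite shiftK.
Qed.

Lemma infinite_sim u : infinite_in s' u -> infinite_in s (shift a u).
Proof. exact: unbounded_sim. Qed.

Lemma sign_sim u v : s' u = s' v <-> s (shift a u) = s (shift a v).
Proof. by split=> /eqP; [rewrite ss|rewrite -ss] => /eqP. Qed.

End Sim.

Section Sim2.
Variables (a : Z2) (s' s : Z2 -> bool).
Hypothesis ss : sim a s' s.
Let ss' := sim_opp ss.

Lemma cluster_simE u v : cluster s' u v <-> cluster s (shift a u) (shift a v).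
Proof. by split=> [/(cluster_sim ss)//|/(cluster_sim ss')]; rewrite !shiftK. Qed.

Lemma infinite_simE u : infinite_in s' u <-> infinite_in s (shift a u).
Proof. by split=> [/(infinite_sim ss)//|/(infinite_sim ss')]; rewrite !shiftK. Qed.

Lemma shiftP (P : Z2 -> Prop) : (forall v, P (shift a v)) -> forall v, P v.
Proof. by move=> h v; rewrite -(shiftNK a v). Qed.

Lemma facing_sim v : facing s' v -> facing s (shift a v).
Proof.
move=> [vi [y [z [vy vNy yz zi]]]]; split; first exact/infinite_simE.
exists (shift a y), (shift a z); split; first exact: nn_shift.
- by move=> /cluster_simE.
- apply: con_shift yz; first exact: nn_shift.
  by move=> x /cluster_simE.
- exact/infinite_simE.
Qed.

Lemma dominant_sim u : dominant s' u -> dominant s (shift a u).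
Proof.
move=> [ui hu]; split; first exact/infinite_simE.
case: hu => [hu|[[v [vi vu uv]] hu]]; [left|right].
  by apply: shiftP => v /infinite_simE/hu/(sign_sim ss).
split.
  exists (shift a v); split; [exact/infinite_simE|exact/(sign_sim ss)|].
  by move=> /cluster_simE.
apply: shiftP => w; apply: shiftP => w' /infinite_simE wi /infinite_simE wi' wu wu'.
by apply/cluster_simE; apply: hu => // /(sign_sim ss).
Qed.

Lemma trifurcation_sim b b' : (forall x, (x \in b') = (shift a x \in b)) ->
  trifurcation b' s' -> trifurcation b s.
Proof.
move=> bb [sc [x [xi xr xN]]]; split.
  apply: shiftP => u; apply: shiftP => v; rewrite -!bb => ub vb.
  exact/(sign_sim ss)/sc.
have bb' y : [set` b] (shift a y) -> [set` b'] y by rewrite /= bb.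
exists (shift a \o x); split=> [k|k|k l kl] /=.
- have [xb xinf] := xi k; split; first by rewrite -bb.
  exact: (unbounded_sim ss) xinf.
- have [u ub xu] := xr k; exists (shift a u); first by rewrite -bb.
  exact/cluster_simE.
- move=> h; apply: (xN k l kl); rewrite -(shiftK a (x k)) -(shiftK a (x l)).
  by apply: (con_sim ss') h => y /=; rewrite bb shiftNK.
Qed.

End Sim2.

(** * The spin fields sigma and tau *)

Definition cross (p : L1config) (u v : Z2) : bool :=
  `[< exists e : L1edge, p e /\ crosses e u v >].

Lemma cross_sym p u v : cross p u v = cross p v u.
Proof.
by apply/asboolP/asboolP => -[e [pe c]]; exists e; split=> //; rewrite /crosses or_comm.
Qed.

Lemma crosses_h (e : L1edge) x y : crosses e (x, y) (x + 1, y) <->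
  sval e = ((x + 1, 2 * ((y - 1) %/ 2)%Z), false).
Proof.
case: e => [[[m n] b] ev]; have /andP[/= m2 n2] := ev.
rewrite /crosses /crossed_pair /ebase /ehoriz /= {ev}; case: b; split=> //.
- by case=> -[[[? ?] [? ?]]|[[? ?] [? ?]]]; lia.
- by case=> -[[[? ?] [? ?]]|[[? ?] [? ?]]]; congr (_, _, _); lia.
- move=> [mE nE]; left; have [h|h] : n + 1 = y \/ n + 2 = y by lia.
    by left; split; congr (_, _); lia.
  by right; split; congr (_, _); lia.
Qed.

Lemma crosses_v (e : L1edge) x y : crosses e (x, y) (x, y + 1) <->
  sval e = ((2 * (x %/ 2)%Z, y), true).
Proof.
case: e => [[[m n] b] ev]; have /andP[/= m2 n2] := ev.
rewrite /crosses /crossed_pair /ebase /ehoriz /= {ev}; case: b; split=> //.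
- by case=> -[[[? ?] [? ?]]|[[? ?] [? ?]]]; congr (_, _, _); lia.
- move=> [mE nE]; left; have [h|h] : m = x \/ m + 1 = x by lia.
    by left; split; congr (_, _); lia.
  by right; split; congr (_, _); lia.
- by case=> -[[[? ?] [? ?]]|[[? ?] [? ?]]]; lia.
Qed.

Lemma cross_one p (e : L1edge) u v : crosses e u v ->
  (forall e' : L1edge, crosses e' u v -> e' = e) -> cross p u v = p e.
Proof.
move=> euv e_uniq; apply/asboolP/idP => [[e' [pe' /e_uniq <-//]]|pe].
by exists e.
Qed.

Lemma cross_h (x y : int) : ~~ (2 %| x)%Z -> exists2 e : L1edge,
  sval e = ((x + 1, 2 * ((y - 1) %/ 2)%Z), false) &
  forall p, cross p (x, y) (x + 1, y) = p e.
Proof.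
move=> x2; have ev : evenZ2 (x + 1, 2 * ((y - 1) %/ 2)%Z).
  by apply/andP; split=> /=; lia.
pose e : L1edge := exist _ ((x + 1, 2 * ((y - 1) %/ 2)%Z), false) ev.
exists e => // q; apply: cross_one; first exact/crosses_h.
by move=> e' /crosses_h ee'; apply: val_inj.
Qed.

Lemma cross_v (x y : int) : (2 %| y)%Z -> exists2 e : L1edge,
  sval e = ((2 * (x %/ 2)%Z, y), true) &
  forall p, cross p (x, y) (x, y + 1) = p e.
Proof.
move=> y2; have ev : evenZ2 (2 * (x %/ 2)%Z, y).
  by apply/andP; split=> /=; lia.
pose e : L1edge := exist _ ((2 * (x %/ 2)%Z, y), true) ev.
exists e => // q; apply: cross_one; first exact/crosses_v.
by move=> e' /crosses_v ee'; apply: val_inj.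
Qed.

Lemma cross_h0 p x y : (2 %| x)%Z -> cross p (x, y) (x + 1, y) = false.
Proof.
move=> x2; apply/asboolP => -[e [_ /crosses_h]].
case: e => [[[m n] b] ev]; have /andP[/= m2 n2] := ev.
by case; lia.
Qed.

Lemma cross_v0 p x y : ~~ (2 %| y)%Z -> cross p (x, y) (x, y + 1) = false.
Proof.
move=> x2; apply/asboolP => -[e [_ /crosses_v]].
case: e => [[[m n] b] ev]; have /andP[/= m2 n2] := ev.
by case; lia.
Qed.

Section Omega.
Variable w : config.
Hypothesis wO : in_Omega w.

Lemma cross_phi1_h x y : cross (phi1 w) (x, y) (x + 1, y) =
  ~~ (2 %| x)%Z && (w (x, y) != w (x + 1, y)).
Proof.
have [x2|x2] := boolP (2 %| x)%Z; first exact: cross_h0.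
have [e eE ->] := cross_h y x2.
rewrite /phi1 /eface /ehoriz /ebase eE /=.
set n := 2 * _; have := wO (f := (x, n + 1)).
rewrite /black /vert_val /ll /ul /ur /lr /= !addrK.
have -> : (2 %| x + (n + 1))%Z by rewrite /n; lia.
move=> /(_ isT); have [->|->] : y = n + 1 \/ y = n + 1 + 1 by rewrite /n; lia.
  by do 4!case: (w _).
by do 4!case: (w _).
Qed.

Lemma cross_phi1_v x y : cross (phi1 w) (x, y) (x, y + 1) =
  (2 %| y)%Z && (w (x, y) != w (x, y + 1)).
Proof.
have [y2|y2] := boolP (2 %| y)%Z; last exact: cross_v0.
have [e eE ->] := cross_v x y2.
rewrite /phi1 /eface /ehoriz /ebase eE /=.
set m := 2 * _; have := wO (f := (m, y)); rewrite /black /horiz_val /ll /ul /ur /lr /=.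
have -> : (2 %| m + y)%Z by rewrite /m; lia.
move=> /(_ isT); have [->|->] : x = m \/ x = m + 1 by rewrite /m; lia.
  by do 4!case: (w _).
by do 4!case: (w _).
Qed.

Lemma closed_phi1 : closed_form (cross (phi1 w)).
Proof.
move=> x y; rewrite !cross_phi1_h !cross_phi1_v.
have := wO (f := (x, y)); rewrite /black /ll /ul /ur /lr /=.
have -> : (2 %| x + y)%Z = ((2 %| x)%Z == (2 %| y)%Z) by lia.
by case: (2 %| x)%Z; case: (2 %| y)%Z => /=;
    [move=> /(_ isT)|move=> _|move=> _|move=> /(_ isT)]; do 4!case: (w _).
Qed.

End Omega.

Definition spin (p : L1config) : config := potential (cross p).

Lemma spin_nn p u v : closed_form (cross p) -> nn u v ->
  spin p u (+) spin p v = cross p u v.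
Proof. by move=> pc; apply: potential_nn => // *; exact: cross_sym. Qed.

Definition sigma (w : config) := spin (phi1 w).
Definition tau (w : config) : config := fun u => sigma w u (+) w u.

Section Omega2.
Variable w : config.
Hypothesis wO : in_Omega w.

Lemma sigma_h x y : sigma w (x + 1, y) =
  sigma w (x, y) (+) (~~ (2 %| x)%Z && (w (x, y) != w (x + 1, y))).
Proof.
rewrite -cross_phi1_h // -spin_nn ?addKb //; first exact: closed_phi1.
by left.
Qed.

Lemma sigma_v x y : sigma w (x, y + 1) =
  sigma w (x, y) (+) ((2 %| y)%Z && (w (x, y) != w (x, y + 1))).
Proof.
rewrite -cross_phi1_v // -spin_nn ?addKb //; first exact: closed_phi1.
by right; right; left.
Qed.

Lemma sigma_eq_h x y : (sigma w (x, y) == sigma w (x + 1, y)) =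
  ~~ (~~ (2 %| x)%Z && (w (x, y) != w (x + 1, y))).
Proof. by rewrite sigma_h; case: (sigma w _); case: (_ && _). Qed.

Lemma sigma_eq_v x y : (sigma w (x, y) == sigma w (x, y + 1)) =
  ~~ ((2 %| y)%Z && (w (x, y) != w (x, y + 1))).
Proof. by rewrite sigma_v; case: (sigma w _); case: (_ && _). Qed.

Lemma tau_eq_h x y : (tau w (x, y) == tau w (x + 1, y)) =
  ~~ ((2 %| x)%Z && (w (x, y) != w (x + 1, y))).
Proof.
by rewrite /tau sigma_h; case: (sigma w _); case: (w _); case: (w _); case: (2 %| x)%Z.
Qed.

Lemma tau_eq_v x y : (tau w (x, y) == tau w (x, y + 1)) =
  ~~ (~~ (2 %| y)%Z && (w (x, y) != w (x, y + 1))).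
Proof.
by rewrite /tau sigma_v; case: (sigma w _); case: (w _); case: (w _); case: (2 %| y)%Z.
Qed.

Lemma sigma_tau_compat : compat (sigma w) (tau w).
Proof.
move=> x y; rewrite /const_on_face /tau !sigma_h !sigma_v.
have := wO (f := (x, y)); rewrite /black /ll /ul /ur /lr /=.
have -> : (2 %| x + y)%Z = ((2 %| x)%Z == (2 %| y)%Z) by lia.
case: (sigma w (x, y)).
  by case: (2 %| x)%Z; case: (2 %| y)%Z => /=;
    [move=> /(_ isT)|move=> _|move=> _|move=> /(_ isT)]; do 4!case: (w _).
by case: (2 %| x)%Z; case: (2 %| y)%Z => /=;
    [move=> /(_ isT)|move=> _|move=> _|move=> /(_ isT)]; do 4!case: (w _).
Qed.

Lemma adj_minusE u v : adj_minus w u v <-> same (sigma w) u v.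
Proof.
split=> -[uv h]; split=> //.
  have := spin_nn (closed_phi1 wO) uv; rewrite (_ : cross _ _ _ = false).
    by rewrite /sigma; case: (spin _ u); case: (spin _ v).
  by apply/asboolP => -[e he]; apply: h; exists e.
move=> [e he]; have := spin_nn (closed_phi1 wO) uv; rewrite -/(sigma w) h addbb.
by move/esym/asboolP; apply; exists e.
Qed.

End Omega2.

Lemma sim_nn a s' s :
  (forall u v, nn u v -> (s' u == s' v) = (s (shift a u) == s (shift a v))) -> sim a s' s.
Proof.
move=> h; have {}h u : s' u (+) s (shift a u) = s' (0, 0) (+) s (shift a (0, 0)).
  elim/Z2_ind: u => // u v /h.
  by case: (s' u); case: (s' v); case: (s _); case: (s (shift a v)).
move=> u v; have := h u; rewrite -(h v).
by case: (s' u); case: (s' v); case: (s _); case: (s _).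
Qed.

Lemma transl_Omega w (a : Z2) : (2 %| a.1 + a.2)%Z -> in_Omega w -> in_Omega (transl a w).
Proof.
move=> a2 wO f f2; have := wO (shift a f); rewrite /black /transl /shift /ll /ul /ur /lr /=.
rewrite !(addrAC _ 1); apply; move: f2; rewrite /black; lia.
Qed.

Lemma sim_edges (s' s : Z2 -> bool) a :
  (forall x y, (s' (x, y) == s' (x + 1, y)) =
    (s (shift a (x, y)) == s (shift a (x + 1, y)))) ->
  (forall x y, (s' (x, y) == s' (x, y + 1)) =
    (s (shift a (x, y)) == s (shift a (x, y + 1)))) ->
  sim a s' s.
Proof.
move=> h v; apply: sim_nn; apply: nn_edge => // u u' _.
by rewrite eq_sym => ->; rewrite eq_sym.
Qed.

Lemma sigma_even w k l : in_Omega w ->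
  sim (2 * k, 2 * l) (sigma (transl (2 * k, 2 * l) w)) (sigma w).
Proof.
move=> wO; have wO' : in_Omega (transl (2 * k, 2 * l) w).
  by apply: transl_Omega => //=; lia.
apply: sim_edges => x y; rewrite /shift /= (addrAC _ 1).
  rewrite !sigma_eq_h // /transl /= (addrAC _ 1).
  by have -> : (2 %| x + 2 * k)%Z = (2 %| x)%Z by lia.
rewrite !sigma_eq_v // /transl /= (addrAC _ 1).
by have -> : (2 %| y + 2 * l)%Z = (2 %| y)%Z by lia.
Qed.

Lemma tau_even w k l : in_Omega w ->
  sim (2 * k, 2 * l) (tau (transl (2 * k, 2 * l) w)) (tau w).
Proof.
move=> wO u v; have := sigma_even k l wO u v; rewrite /tau /transl -/(transl _ w).
rewrite -!/(shift _ _) /=.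
case: (sigma _ u); case: (sigma _ v); case: (sigma _ _); case: (sigma _ _);
  by case: (w _); case: (w _).
Qed.

Lemma sigma_tau w : in_Omega w -> sim (1, 1) (sigma (transl (1, 1) w)) (tau w).
Proof.
move=> wO; have wO' : in_Omega (transl (1, 1) w).
  exact: transl_Omega.
apply: sim_edges => x y; rewrite /shift /= (addrAC _ 1).
  rewrite sigma_eq_h // tau_eq_h // /transl /= (addrAC _ 1).
  by have -> : (2 %| x + 1)%Z = ~~ (2 %| x)%Z by lia.
rewrite sigma_eq_v // tau_eq_v // /transl /= (addrAC _ 1).
have -> : (2 %| y + 1)%Z = ~~ (2 %| y)%Z by lia.
by rewrite negbK.
Qed.

Lemma phi1_theta w : phi1 (theta w) = phi1 w.
Proof.
apply/funext => e; rewrite /phi1 /horiz_val /vert_val /theta /=.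
by case: ifP => _; do 4!case: (w _).
Qed.

Lemma theta_Omega w : in_Omega w -> in_Omega (theta w).
Proof. by move=> wO f /wO; rewrite /theta /=; do 4!case: (w _). Qed.

Lemma sigma_theta w : sigma (theta w) = sigma w.
Proof. by rewrite /sigma phi1_theta. Qed.

Lemma tau_theta w u : tau (theta w) u = ~~ tau w u.
Proof. by rewrite /tau sigma_theta /theta addbN. Qed.

Definition block (S : Z2) : seq Z2 := tile S 2.

Lemma cross_flip S p u v : evenZ2 S -> nn u v ->
  cross (flipS S p) u v = cross p u v (+) ((u \in block S) (+) (v \in block S)).
Proof.
move=> /andP[S1 S2]; move: u v; apply: nn_edge => [u v _|x y|x y].
- by rewrite cross_sym => ->; rewrite (cross_sym p) (addbC (u \in _)).
- rewrite !mem_tile /=; have [x2|x2] := boolP (2 %| x)%Z.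
    by rewrite !cross_h0 //; lia.
  have [e eE h] := cross_h y x2.
  rewrite !h /flipS /side_of eE !xpair_eqE /= !andbF !andbT /=.
  rewrite (_ : _ || _ = (x + 1 == S.1) && (2 * ((y - 1) %/ 2)%Z == S.2)
       || (x + 1 == S.1 + 2) && (2 * ((y - 1) %/ 2)%Z == S.2)); last first.
    by case: S S1 S2 => S1 S2; rewrite /= !xpair_eqE.
  have -> : (2 * ((y - 1) %/ 2)%Z == S.2) = (S.2 + 1 <= y) && (y < S.2 + 1 + 2%:Z) by lia.
  have -> : (x + 1 == S.1) = (S.1 <= x + 1) && ~~ (S.1 <= x) by lia.
  have -> : (x + 1 == S.1 + 2) = (x < S.1 + 2%:Z) && ~~ (x + 1 < S.1 + 2%:Z) by lia.
  case: (_ && (y < _)); last by rewrite !andbF; case: (p e).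
  have : (S.1 <= x) ==> (S.1 <= x + 1) by lia.
  have : (x + 1 < S.1 + 2%:Z) ==> (x < S.1 + 2%:Z) by lia.
  have : (S.1 <= x) || (x + 1 < S.1 + 2%:Z) by lia.
  rewrite !andbT; case: (S.1 <= x); case: (S.1 <= x + 1);
    by case: (x < _); case: (x + 1 < _); case: (p e).
- rewrite !mem_tile /=; have [y2|y2] := boolP (2 %| y)%Z; last first.
    by rewrite !cross_v0 //; lia.
  have [e eE h] := cross_v x y2.
  rewrite !h /flipS /side_of eE !xpair_eqE /= !andbF !andbT /=.
  rewrite (_ : _ || _ = (2 * (x %/ 2)%Z == S.1) && (y == S.2)
       || (2 * (x %/ 2)%Z == S.1) && (y == S.2 + 2)); last first.
    by case: S S1 S2 => S1 S2; rewrite /= !xpair_eqE !orbF.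
  have -> : (2 * (x %/ 2)%Z == S.1) = (S.1 <= x) && (x < S.1 + 2%:Z) by lia.
  have -> : (y == S.2) = (S.2 + 1 <= y + 1) && ~~ (S.2 + 1 <= y) by lia.
  have -> : (y == S.2 + 2) = (y < S.2 + 1 + 2%:Z) && ~~ (y + 1 < S.2 + 1 + 2%:Z) by lia.
  rewrite !andbA; case: (_ && (x < _)) => /=; last by case: (p e).
  have : (S.2 + 1 <= y) ==> (S.2 + 1 <= y + 1) by lia.
  have : (y + 1 < S.2 + 1 + 2%:Z) ==> (y < S.2 + 1 + 2%:Z) by lia.
  have : (S.2 + 1 <= y) || (y + 1 < S.2 + 1 + 2%:Z) by lia.
  case: (S.2 + 1 <= y); case: (S.2 + 1 <= y + 1);
    by case: (y < _); case: (y + 1 < _); case: (p e).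
Qed.

Lemma closed_flip S p : evenZ2 S -> closed_form (cross p) -> closed_form (cross (flipS S p)).
Proof.
move=> S2 pc x y; rewrite !cross_flip //; try by [left|right; right; left].
have := pc x y; set c1 := cross _ _ _; set c2 := cross _ _ _.
set c3 := cross _ _ _; set c4 := cross _ _ _.
by case: c1; case: c2; case: c3; case: c4 => // _; do 4!case: (_ \in _).
Qed.

Lemma spin_flip S p : evenZ2 S -> closed_form (cross p) ->
  sim 0 (spin (flipS S p)) (fun u => spin p u (+) (u \in block S)).
Proof.
move=> S2 pc; apply: sim_nn => u v uv; have sh0 x : shift 0 x = x.
  by case: x => *; rewrite /shift /= !addr0.
rewrite !sh0; have := spin_nn (closed_flip S2 pc) uv.
have := spin_nn pc uv; rewrite cross_flip // => <-.
case: (spin _ u); case: (spin _ v); case: (spin _ u); case: (spin _ v);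
  by do 2!case: (_ \in _).
Qed.

(** * Measurability *)

Section MeasurablePredicates.
Context {d : measure_display} {X : measurableType d}.
Implicit Types (P Q : X -> Prop) (b : X -> bool).

Definition mpred P := measurable [set x | P x].

Lemma mpred_ext P Q : (forall x, P x <-> Q x) -> mpred P -> mpred Q.
Proof.
move=> PQ; rewrite /mpred (_ : [set x | P x] = [set x | Q x]) //.
by apply/seteqP; split=> x /PQ.
Qed.

Lemma mpred_cst (A : Prop) : mpred (fun=> A).
Proof.
have [a|na] := pselect A; rewrite /mpred.
  by rewrite (_ : mkset _ = setT) //; apply/seteqP; split.
by rewrite (_ : mkset _ = set0) //; apply/seteqP; split.
Qed.

Lemma mpred_not P : mpred P -> mpred (fun x => ~ P x).
Proof. by move=> /measurableC; rewrite /mpred. Qed.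

Lemma mpred_and P Q : mpred P -> mpred Q -> mpred (fun x => P x /\ Q x).
Proof. by move=> mP mQ; exact: measurableI mP mQ. Qed.

Lemma mpred_or P Q : mpred P -> mpred Q -> mpred (fun x => P x \/ Q x).
Proof. by move=> mP mQ; exact: measurableU mP mQ. Qed.

Lemma mpred_imp P Q : mpred P -> mpred Q -> mpred (fun x => P x -> Q x).
Proof.
move=> mP mQ; apply: (@mpred_ext (fun x => ~ P x \/ Q x)); first last.
  by apply: mpred_or => //; exact: mpred_not.
by move=> x; split=> [[]//|PQ]; have [/PQ|] := pselect (P x); [right|left].
Qed.

Lemma mpred_and3 P Q P' : mpred P -> mpred Q -> mpred P' ->
  mpred (fun x => [/\ P x, Q x & P' x]).
Proof.
move=> mP mQ mP'; apply: (@mpred_ext (fun x => P x /\ (Q x /\ P' x))).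
  by move=> x; split=> [[? []]|[]].
by do 2!apply: mpred_and => //.
Qed.

Lemma mpred_and4 P Q P' Q' : mpred P -> mpred Q -> mpred P' -> mpred Q' ->
  mpred (fun x => [/\ P x, Q x, P' x & Q' x]).
Proof.
move=> mP mQ mP' mQ'; apply: (@mpred_ext (fun x => P x /\ [/\ Q x, P' x & Q' x])).
  by move=> x; split=> [[? []]|[]].
by apply: mpred_and => //; exact: mpred_and3.
Qed.

Lemma mpred_ex (T : countType) (P : T -> X -> Prop) :
  (forall t, mpred (P t)) -> mpred (fun x => exists t, P t x).
Proof.
move=> mP; rewrite /mpred.
rewrite (_ : mkset _ =
    \bigcup_n (if unpickle n is Some t then [set x | P t x] else set0)).
  by apply: bigcupT_measurable => n; case: unpickle.
apply/seteqP; split=> [x [t Ptx]|x [n _]].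
  by exists (pickle t) => //; rewrite pickleK.
by case: unpickle => // t Pt; exists t.
Qed.

Lemma mpred_ex2 (T : countType) (P Q : T -> X -> Prop) :
  (forall t, mpred (P t)) -> (forall t, mpred (Q t)) ->
  mpred (fun x => exists2 t, P t x & Q t x).
Proof.
move=> mP mQ; apply: (@mpred_ext (fun x => exists t, P t x /\ Q t x)).
  by move=> x; split=> [[t []]|[t]]; exists t.
by apply: mpred_ex => t; exact: mpred_and.
Qed.

Lemma mpred_all (T : countType) (P : T -> X -> Prop) :
  (forall t, mpred (P t)) -> mpred (fun x => forall t, P t x).
Proof.
move=> mP; apply: (@mpred_ext (fun x => ~ exists t, ~ P t x)).
  by move=> x; split=> [/forallNP h t|h [t]//]; apply: contrapT; apply: h.
by apply: mpred_not; apply: mpred_ex => t; exact: mpred_not.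
Qed.

Lemma mpred_neg b : mpred b -> mpred (fun x => ~~ b x).
Proof.
move=> /mpred_not; apply: mpred_ext => x; by split=> [/negP|/negP].
Qed.

Lemma mpred_andb b b' : mpred b -> mpred b' -> mpred (fun x => b x && b' x).
Proof.
by move=> mb mb'; apply: mpred_ext (mpred_and mb mb') => x; split=> [/andP|/andP].
Qed.

Lemma mpred_orb b b' : mpred b -> mpred b' -> mpred (fun x => b x || b' x).
Proof.
by move=> mb mb'; apply: mpred_ext (mpred_or mb mb') => x; split=> [/orP|/orP].
Qed.

Lemma mpred_addb b b' : mpred b -> mpred b' -> mpred (fun x => b x (+) b' x).
Proof.
move=> mb mb'; apply: (@mpred_ext (fun x => (b x && ~~ b' x) || (~~ b x && b' x))).
  by move=> x; case: (b x); case: (b' x).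
by apply: mpred_orb; apply: mpred_andb => //; exact: mpred_neg.
Qed.

Lemma mpred_eqb b b' : mpred b -> mpred b' -> mpred (fun x => b x == b' x).
Proof.
move=> mb mb'; apply: mpred_ext (mpred_neg (mpred_addb mb mb')) => x.
by case: (b x); case: (b' x).
Qed.

Lemma mpred_eq b b' : mpred b -> mpred b' -> mpred (fun x => b x = b' x).
Proof.
move=> mb mb'; apply: mpred_ext (mpred_eqb mb mb') => x.
by split=> /eqP.
Qed.

Lemma mpred_asbool P : mpred P -> mpred (fun x => `[< P x >] : Prop).
Proof. by apply: mpred_ext => x; split=> /asboolP. Qed.

Lemma mpred_con (r : X -> Z2 -> Z2 -> Prop) (B : X -> set Z2) :
  (forall u v, mpred (fun x => r x u v)) -> (forall u, mpred (fun x => B x u)) ->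
  forall u v, mpred (fun x => con (r x) (B x) u v).
Proof.
move=> mr mB u v.
pose fix walk x (n : nat) v {struct n} := if n is n'.+1 then
  exists w, walk x n' w /\ avoid (r x) (B x) w v else u = v.
apply: (@mpred_ext (fun x => exists n, walk x n v)).
  move=> x; split=> [[n]|/clos_rt_rtn1_iff].
    elim: n v => [v <-|n IH v [w [/IH uw wv]]]; first exact: con_refl.
    by apply: con_trans uw _; exact: rt_step.
  elim=> [|w w' ww' _ [n uw]]; first by exists 0.
  by exists n.+1, w.
apply: mpred_ex => n; elim: n v => [|n IH] v; first exact: mpred_cst.
apply: mpred_ex => w; apply: mpred_and => //.
by apply: mpred_and3 => //; apply: mpred_not.
Qed.

Lemma mpred_unbounded (r : X -> Z2 -> Z2 -> Prop) (B : X -> set Z2) :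
  (forall u v, mpred (fun x => r x u v)) -> (forall u, mpred (fun x => B x u)) ->
  forall u, mpred (fun x => unbounded (r x) (B x) u).
Proof.
move=> mr mB u; apply: mpred_all => l; apply: mpred_ex2 => v.
  exact: mpred_con.
exact: mpred_cst.
Qed.

Definition measurable_coords (s : X -> config) := forall u, mpred (fun x => s x u).

Lemma measurable_coords_preimage (s : X -> config) (G : config -> Prop) :
  measurable_coords s -> measurable ([set w : Cfg | G w]) -> mpred (fun x => G (s x)).
Proof.
move=> ms mG; have mf : measurable_fun (U := Cfg) setT s.
  apply: (@measurability _ _ X Cfg setT s cyl) => //= _ [_ [u [b ->]] <-]; rewrite setTI.
  have := ms u; case: b; rewrite /mpred.
    by [].
  by move=> /measurableC; congr measurable; apply/seteqP; split=> x /=; case: (s x u).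
by have := mf measurableT _ mG; rewrite setTI.
Qed.

Lemma L1_preimage (p : X -> L1config) (G : L1config -> Prop) :
  (forall e, mpred (fun x => p x e)) -> measurable ([set q : L1Cfg | G q]) ->
  mpred (fun x => G (p x)).
Proof.
move=> mp mG; have mf : measurable_fun (U := L1Cfg) setT p.
  apply: (@measurability _ _ X L1Cfg setT p cylE) => //= _ [_ [e [b ->]] <-]; rewrite setTI.
  have := mp e; case: b; rewrite /mpred.
    by [].
  by move=> /measurableC; congr measurable; apply/seteqP; split=> x /=; case: (p x e).
by have := mf measurableT _ mG; rewrite setTI.
Qed.

Section Coordinates.
Variable s : X -> config.
Hypothesis ms : measurable_coords s.

Lemma mpred_same u v : mpred (fun x => same (s x) u v).
Proof. by apply: mpred_and; [exact: mpred_cst|exact: mpred_eq]. Qed.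

Lemma mpred_cluster u v : mpred (fun x => cluster (s x) u v).
Proof. by apply: mpred_con => *; [exact: mpred_same|exact: mpred_cst]. Qed.

Lemma mpred_infinite u : mpred (fun x => infinite_in (s x) u).
Proof. by apply: mpred_unbounded => *; [exact: mpred_same|exact: mpred_cst]. Qed.

Lemma mpred_facing u : mpred (fun x => facing (s x) u).
Proof.
apply: mpred_and; first exact: mpred_infinite.
apply: mpred_ex => y; apply: mpred_ex => z; apply: mpred_and4.
- exact: mpred_cst.
- by apply/mpred_not/mpred_cluster.
- by apply: mpred_con => *; [exact: mpred_cst|exact: mpred_cluster].
- exact: mpred_infinite.
Qed.

Lemma mpred_dominant u : mpred (fun x => dominant (s x) u).
Proof.
apply: mpred_and; first exact: mpred_infinite; apply: mpred_or.
  by apply: mpred_all => v; apply: mpred_imp; [exact: mpred_infinite|exact: mpred_eq].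
apply: mpred_and.
  apply: mpred_ex => v; apply: mpred_and3; first exact: mpred_infinite.
    exact: mpred_eq.
  exact/mpred_not/mpred_cluster.
apply: mpred_all => v; apply: mpred_all => v'.
apply: mpred_imp; first exact: mpred_infinite.
apply: mpred_imp; first exact: mpred_infinite.
apply: mpred_imp; first exact/mpred_not/mpred_eq.
apply: mpred_imp; first exact/mpred_not/mpred_eq.
exact: mpred_cluster.
Qed.

Lemma mpred_trifurcation (b : seq Z2) : mpred (fun x => trifurcation b (s x)).
Proof.
apply: mpred_and.
  apply: mpred_all => u; apply: mpred_all => v.
  do 2!(apply: mpred_imp; first exact: mpred_cst).
  exact: mpred_eq.
pose T := {ffun 'I_3 -> Z2}.
apply: (@mpred_ext (fun x => exists y : T,
  [/\ forall a, y a \notin b /\ unbounded (same (s x)) [set` b] (y a),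
      forall a, exists2 u, u \in b & cluster (s x) (y a) u &
      forall a a', a != a' -> ~ con (same (s x)) [set` b] (y a) (y a')])).
  move=> x; split=> [[y hy]|[y [h1 h2 h3]]]; first by exists y.
  exists (finfun y); split=> a *; rewrite !ffunE; [exact: h1|exact: h2|exact: h3].
apply: mpred_ex => y; apply: mpred_and3; apply: mpred_all => a.
- apply: mpred_and; first exact: mpred_cst.
  by apply: mpred_unbounded => *; [exact: mpred_same|exact: mpred_cst].
- by apply: mpred_ex2 => u; [exact: mpred_cst|exact: mpred_cluster].
- apply: mpred_all => a'; apply: mpred_imp; first exact: mpred_cst.
  by apply/mpred_not/mpred_con => *; [exact: mpred_same|exact: mpred_cst].
Qed.

Lemma mpred_in_Omega : mpred (fun x => in_Omega (s x)).
Proof.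
apply: mpred_all => f; apply: mpred_imp; first exact: mpred_cst.
by do ![apply: mpred_orb | apply: mpred_andb | apply: mpred_neg | exact: ms].
Qed.

End Coordinates.

Lemma mpred_primitive (f : X -> int -> bool) n : (forall i, mpred (fun x => f x i)) ->
  mpred (fun x => primitive (f x) n).
Proof.
move=> mf; case: n => n; [|rewrite /primitive; move: n.+1 => {}n];
  by elim: n => [|n IH] /=; [exact: mpred_cst|exact: mpred_addb].
Qed.

Lemma mpred_cross (p : X -> L1config) u v : (forall e, mpred (fun x => p x e)) ->
  mpred (fun x => cross (p x) u v).
Proof.
move=> mp; apply/mpred_asbool/mpred_ex => e; apply: mpred_and => //.
exact: mpred_cst.
Qed.

Lemma measurable_coords_spin (p : X -> L1config) : (forall e, mpred (fun x => p x e)) ->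
  measurable_coords (fun x => spin (p x)).
Proof.
by move=> mp u; apply: mpred_addb; apply: mpred_primitive => i; exact: mpred_cross.
Qed.

Lemma mpred_closed (p : X -> L1config) : (forall e, mpred (fun x => p x e)) ->
  mpred (fun x => closed_form (cross (p x))).
Proof.
move=> mp; apply: mpred_all => x; apply: mpred_all => y.
by apply: mpred_eq; apply: mpred_addb; exact: mpred_cross.
Qed.

End MeasurablePredicates.

Lemma mpred_Cfg u : mpred (fun w : Cfg => w u).
Proof. by apply: sub_sigma_algebra; exists u, true. Qed.

Lemma mpred_L1Cfg e : mpred (fun p : L1Cfg => p e).
Proof. by apply: sub_sigma_algebra; exists e, true. Qed.

Lemma mpred_phi1 e : mpred (fun w : Cfg => phi1 w e).
Proof.
rewrite /phi1; case: (ehoriz e);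
  by do ![apply: mpred_andb | apply: mpred_neg | apply: mpred_eqb | exact: mpred_Cfg].
Qed.

Lemma measurable_coords_sigma : measurable_coords (fun w : Cfg => sigma w).
Proof.
by apply: (measurable_coords_spin (p := fun w : Cfg => phi1 w)) => e; exact: mpred_phi1.
Qed.

Lemma measurable_coords_tau : measurable_coords (fun w : Cfg => tau w).
Proof. by move=> u; apply: mpred_addb; [exact: measurable_coords_sigma|exact: mpred_Cfg]. Qed.

(** * Almost sure properties *)

Definition block_sum (l : seq Z2) (u : Z2) : bool :=
  foldr (fun S b => b (+) (u \in block S)) false l.

Section Fillable.
Variables (a : Z2) (n : nat) (c : bool) (s : config).
Hypothesis s_block : forall u v, (u.1 %/ 2)%Z = (v.1 %/ 2)%Z ->
  ((u.2 - 1) %/ 2)%Z = ((v.2 - 1) %/ 2)%Z -> s u = s v.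

Lemma block_sum_uniq l u : uniq l -> all evenZ2 l ->
  block_sum l u = ((2 * (u.1 %/ 2)%Z, 2 * ((u.2 - 1) %/ 2)%Z) \in l).
Proof.
elim: l => //= S l IH /andP[Sl ul] /andP[/andP[S1 S2] el]; rewrite IH // [RHS]inE.
rewrite mem_tile /=; set S0 := (_, _).
have -> : [&& S.1 <= u.1, u.1 < S.1 + 2%:Z, S.2 + 1 <= u.2 & u.2 < S.2 + 1 + 2%:Z] = (S0 == S).
  by rewrite /S0; case: S S1 S2 {Sl S0} => S1 S2 /= ? ?; rewrite xpair_eqE; lia.
case: eqP => [->|_]; last by rewrite addbF.
by rewrite (negbTE Sl).
Qed.

Lemma fill_blocks : evenZ2 a ->
  exists2 l, all evenZ2 l & fill (tile a n.*2) c s = fun u => s u (+) block_sum l u.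
Proof.
move=> /andP[a1 a2].
pose l := [seq S <- tile (a.1, a.2 - 1) n.*2 | evenZ2 S && (s (S.1, S.2 + 1) != c)].
have el : all evenZ2 l by apply/allP => S; rewrite mem_filter => /andP[/andP[]].
exists l => //; apply/funext => u; rewrite block_sum_uniq //; last first.
  apply/filter_uniq/allpairs_uniq; rewrite ?iota_uniq // => -[i j] [i' j'] _ _ /= [ii jj].
  by congr (_, _); lia.
rewrite mem_filter mem_tile /= /fill mem_tile.
have -> : evenZ2 (2 * (u.1 %/ 2)%Z, 2 * ((u.2 - 1) %/ 2)%Z) by apply/andP; split=> /=; lia.
rewrite (s_block (v := u)) /=; [|lia|lia].
have -> : [&& a.1 <= 2 * (u.1 %/ 2)%Z, 2 * (u.1 %/ 2)%Z < a.1 + n.*2%:Z,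
     a.2 - 1 + 1 <= 2 * ((u.2 - 1) %/ 2)%Z & 2 * ((u.2 - 1) %/ 2)%Z < a.2 - 1 + 1 + n.*2%:Z] =
   [&& a.1 <= u.1, u.1 < a.1 + n.*2%:Z, a.2 + 1 <= u.2 & u.2 < a.2 + 1 + n.*2%:Z] by lia.
case: ifP => _; last by rewrite andbF addbF.
by case: (s u); case: (c).
Qed.

End Fillable.

Lemma sigma_block w u v : in_Omega w -> (u.1 %/ 2)%Z = (v.1 %/ 2)%Z ->
  ((u.2 - 1) %/ 2)%Z = ((v.2 - 1) %/ 2)%Z -> sigma w u = sigma w v.
Proof.
case: u v => x y [x' y'] wO /= xx yy.
transitivity (sigma w (x', y)).
  have [->//|[e|e]] : x = x' \/ x = x' + 1 \/ x' = x + 1 by lia.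
    by rewrite e sigma_h //= (_ : _ && _ = false) ?addbF //; lia.
  by rewrite e sigma_h //= (_ : _ && _ = false) ?addbF //; lia.
have [->//|[e|e]] : y = y' \/ y = y' + 1 \/ y' = y + 1 by lia.
  by rewrite e sigma_v //= (_ : _ && _ = false) ?addbF //; lia.
by rewrite e sigma_v //= (_ : _ && _ = false) ?addbF //; lia.
Qed.

Lemma translK a w : transl (- a) (transl a w) = w.
Proof. by apply/funext => -[x y]; rewrite /transl /= !subrK. Qed.

Lemma thetaK w : theta (theta w) = w.
Proof. by apply/funext => x; rewrite /theta negbK. Qed.

Definition sim_invariant (G : config -> Prop) :=
  forall a s' s, sim a s' s -> G s' -> G s.

Section Measure.
Context {R : realType} (mu : probability Cfg R).
Hypothesis HOmega : {ae mu, forall w : Cfg, in_Omega w}.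
Hypothesis A1 : forall (k l : int) (A : set Cfg), measurable A ->
  mu (transl (k + l, k - l) @^-1` A) = mu A.
Hypothesis A2 : forall A : set Cfg, measurable A ->
  (forall k l : int, transl (2 * k, 2 * l) @^-1` A = A) -> mu A = 0%E \/ mu A = 1%E.
Hypothesis A3 : forall A : set Cfg, measurable A -> mu (theta @^-1` A) = mu A.
Hypothesis A4 : forall (S : Z2), evenZ2 S -> forall E : set L1Cfg, measurable E ->
  (0 < mu (phi1 @^-1` E))%E -> (0 < mu (phi1 @^-1` (flipS S @` E)))%E.

Lemma ae_imp (P Q : Cfg -> Prop) : (forall w, P w -> Q w) ->
  {ae mu, forall w, P w} -> {ae mu, forall w, Q w}.
Proof. exact: (filterS (F := almost_everywhere mu)). Qed.

Lemma ae_imp2 (P Q S : Cfg -> Prop) : (forall w, P w -> Q w -> S w) ->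
  {ae mu, forall w, P w} -> {ae mu, forall w, Q w} -> {ae mu, forall w, S w}.
Proof. exact: (filterS2 (F := almost_everywhere mu)). Qed.

Lemma ae_imp3 (P Q S T : Cfg -> Prop) : (forall w, P w -> Q w -> S w -> T w) ->
  {ae mu, forall w, P w} -> {ae mu, forall w, Q w} -> {ae mu, forall w, S w} ->
  {ae mu, forall w, T w}.
Proof. exact: (filterS3 (F := almost_everywhere mu)). Qed.

Lemma mu_transl (a : Z2) (A : set Cfg) : (2 %| a.1 + a.2)%Z -> measurable A ->
  mu (transl a @^-1` A) = mu A.
Proof.
move=> a2 mA; pose k := ((a.1 + a.2) %/ 2)%Z; pose l := ((a.1 - a.2) %/ 2)%Z.
have -> : a = (k + l, k - l) by case: a a2 @k @l => a1 a2 /= h; congr (_, _); lia.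
exact: A1.
Qed.

Lemma mpred_Omega : mpred (fun w : Cfg => in_Omega w).
Proof. by apply: mpred_in_Omega => u; exact: mpred_Cfg. Qed.

Lemma ae_null (P : Cfg -> Prop) : mpred P ->
  {ae mu, forall w : Cfg, ~ P w} <-> mu [set w | P w] = 0%E.
Proof.
move=> mP; rewrite -(negligibleP mu mP).
rewrite -[X in _ <-> mu.-negligible X]setCK; exact: iff_refl.
Qed.

Lemma zero_one (P : Cfg -> Prop) : mpred P ->
  (forall a w, evenZ2 a -> P (transl a w) -> P w) ->
  mu [set w | P w] = 0%E \/ mu [set w | P w] = 1%E.
Proof.
move=> mP Pinv; apply: A2 => // k l; have ev k' l' : evenZ2 (2 * k', 2 * l').
  by apply/andP; split=> /=; lia.
apply/seteqP; split=> w /=; first exact: Pinv.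
rewrite -{1}(translK (2 * k, 2 * l) w) => /Pinv; apply.
by rewrite (_ : - _ = (2 * - k, 2 * - l)) // /GRing.opp /= !mulrN.
Qed.

Lemma sigma_translate a w : evenZ2 a -> in_Omega w -> sim a (sigma (transl a w)) (sigma w).
Proof.
case: a => a1 a2 /andP[/= h1 h2] wO.
have -> : (a1, a2) = (2 * (a1 %/ 2)%Z, 2 * (a2 %/ 2)%Z) by congr (_, _); lia.
exact: sigma_even.
Qed.

Lemma tau_translate a w : evenZ2 a -> in_Omega w -> sim a (tau (transl a w)) (tau w).
Proof.
case: a => a1 a2 /andP[/= h1 h2] wO.
have -> : (a1, a2) = (2 * (a1 %/ 2)%Z, 2 * (a2 %/ 2)%Z) by congr (_, _); lia.
exact: tau_even.
Qed.

Lemma Omega_transl a w : evenZ2 a -> in_Omega (transl a w) -> in_Omega w.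
Proof.
move=> /andP[a1 a2] /(@transl_Omega _ (- a)); rewrite translK; apply.
by case: a a1 a2 => ? ? /=; lia.
Qed.

Section Parity.
Variable Q : config -> config -> Z2 -> Z2 -> Prop.
Hypothesis mQ : forall u v, mpred (fun w : Cfg => Q (sigma w) (tau w) u v).
Hypothesis Q_sim : forall a s' s t' t u v, sim a s' s -> sim a t' t ->
  Q s' t' u v -> Q s t (shift a u) (shift a v).

Let selects b (w : Cfg) := in_Omega w /\
  ((exists u v, Q (sigma w) (tau w) u v) /\
   forall u v, Q (sigma w) (tau w) u v -> sigma w u (+) tau w v = b).

Lemma mpred_selects b : mpred (selects b).
Proof.
apply: mpred_and; first exact: mpred_Omega; apply: mpred_and.
  by do 2!apply: mpred_ex => ?.
apply: mpred_all => u; apply: mpred_all => v; apply: mpred_imp => //.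
apply: mpred_eq; last exact: mpred_cst.
by apply: mpred_addb; [exact: measurable_coords_sigma|exact: measurable_coords_tau].
Qed.

Lemma selects_transl b a w : evenZ2 a -> selects b (transl a w) -> selects b w.
Proof.
move=> a2 [wO' [[u [v Quv]] Qb]]; have wO := Omega_transl a2 wO'.
have sS := sigma_translate a2 wO; have tS := tau_translate a2 wO.
split=> //; split; first by exists (shift a u), (shift a v); exact: Q_sim Quv.
apply: (shiftP (a := a)) => x; apply: (shiftP (a := a)) => y Qxy.
have /Qb <- : Q (sigma (transl a w)) (tau (transl a w)) x y.
  rewrite -(shiftK a x) -(shiftK a y); apply: Q_sim Qxy; exact: sim_opp.
have : sigma (transl a w) y (+) tau (transl a w) y = sigma w (shift a y) (+) tau w (shift a y).
  by rewrite /tau !addKb.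
have := sS x y.
case: (sigma _ x); case: (sigma _ y); case: (tau _ y); case: (sigma w _);
  by case: (sigma w _); case: (tau w _).
Qed.

Lemma selects_theta b w : selects b (theta w) -> selects (~~ b) w.
Proof.
move=> [/theta_Omega]; rewrite thetaK sigma_theta => wO [[u [v Quv]] Qb].
have tS := sim_neg (tau_theta w).
split=> //; split; first by exists u, v; have := Q_sim (sim_refl _) tS Quv; rewrite !shift0.
move=> x y Qxy; rewrite -(Qb x y) ?tau_theta ?addbN ?negbK //.
have := Q_sim (sim_refl _) (sim_opp tS) Qxy.
by rewrite !shift0.
Qed.

Lemma parity_ae : {ae mu, forall w : Cfg,
  ~ ((exists u v, Q (sigma w) (tau w) u v) /\
     forall u v u' v', Q (sigma w) (tau w) u v -> Q (sigma w) (tau w) u' v' ->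
       sigma w u (+) tau w v = sigma w u' (+) tau w v')}.
Proof.
have tf : mu [set w | selects true w] = mu [set w | selects false w].
  rewrite -A3; last exact: mpred_selects.
  congr (mu _); apply/seteqP; split=> w /=; first exact: selects_theta.
  by move=> Pw; apply: (@selects_theta false); rewrite thetaK.
have null : mu [set w | selects true w] = 0%E.
  have [//|t1] := zero_one (mpred_selects true) (@selects_transl true).
  have : (mu ([set w | selects true w] `|` [set w | selects false w]) <= 1)%E.
    by apply: probability_le1; apply: measurableU; exact: mpred_selects.
  have -> : mu ([set w | selects true w] `|` [set w | selects false w]) =
      (mu [set w | selects true w] + mu [set w | selects false w])%E.
    apply: measureU; [exact: mpred_selects|exact: mpred_selects|].
    apply/seteqP; split=> // w [[_ [[u [v Quv]] Pt]] [_ [_ Pf]]].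
    by have := Pt _ _ Quv; rewrite Pf.
  rewrite -tf t1 -EFinD lee_fin => h; exfalso; move: h; apply/negP.
  by rewrite -ltNge ltrDl.
have nt := (ae_null (mpred_selects true)).2 null.
rewrite tf in null; have nf := (ae_null (mpred_selects false)).2 null.
move: HOmega nt nf; apply: ae_imp3 => w wO nt nf [[u [v Quv]] Qc].
case e : (sigma w u (+) tau w v); [apply: nt|apply: nf]; split=> //;
  by split=> [|u' v' Q']; [exists u, v|rewrite (Qc _ _ _ _ Q' Quv)].
Qed.

End Parity.

Lemma zero_one_sigma (G : config -> Prop) : mpred (fun w : Cfg => G w) -> sim_invariant G ->
  {ae mu, forall w : Cfg, ~ G (sigma w)} \/ {ae mu, forall w : Cfg, G (sigma w)}.
Proof.
move=> mG Ginv; pose P (w : Cfg) := in_Omega w /\ G (sigma w).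
have mP : mpred P.
  apply: mpred_and; first exact: mpred_Omega.
  exact: measurable_coords_preimage measurable_coords_sigma mG.
have mP' : mpred (fun w => ~ P w) by exact: mpred_not.
have [a w a2 [wO' Gw]|h|h] := zero_one mP.
- have wO := Omega_transl a2 wO'; split=> //; apply: Ginv Gw; exact: sigma_translate.
- left; move: HOmega ((ae_null mP).2 h); apply: ae_imp2 => w wO nP Gw.
  by apply: nP.
- right; have : mu [set w | ~ P w] = 0%E.
    have := probability_setC mu mP; rewrite h subee //; congr (mu _ = _).
  move=> /(ae_null mP'); apply: ae_imp => w /contrapT[]//.
Qed.

Lemma ae_tau (G : config -> Prop) : mpred (fun w : Cfg => G w) -> sim_invariant G ->
  {ae mu, forall w : Cfg, G (sigma w)} -> {ae mu, forall w : Cfg, G (tau w)}.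
Proof.
move=> mG Ginv Gsg; pose P (w : Cfg) := ~ G (sigma w).
have mP : mpred P.
  by apply/mpred_not; exact: measurable_coords_preimage measurable_coords_sigma mG.
have P0 : mu [set w | P w] = 0%E.
  by apply/(ae_null mP); move: Gsg; apply: ae_imp => w Gw; apply.
have mP1 : mpred (fun w : Cfg => P (transl (1, 1) w)).
  apply: (measurable_coords_preimage (s := transl (1, 1) : Cfg -> config) _ mP) => u.
  exact: mpred_Cfg.
have : mu [set w : Cfg | P (transl (1, 1) w)] = 0%E.
  by rewrite -P0; apply: (mu_transl (a := (1, 1))).
move=> /(ae_null mP1); move: HOmega; apply: ae_imp2 => w wO /contrapT.
by apply: Ginv; exact: sigma_tau.
Qed.

Lemma ae_flip (G : config -> Prop) S : evenZ2 S ->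
  mpred (fun w : Cfg => G w) -> (forall s' s, sim 0 s' s -> G s' -> G s) ->
  {ae mu, forall w : Cfg, G (sigma w)} ->
  {ae mu, forall w : Cfg, G (fun u => sigma w u (+) (u \in block S))}.
Proof.
move=> S2 mG Ginv Gsg.
pose badly (p : L1Cfg) := closed_form (cross p) /\ ~ G (fun u => spin p u (+) (u \in block S)).
pose E := [set p : L1Cfg | badly p].
have mE : mpred badly.
  apply: mpred_and; first by apply: mpred_closed; exact: mpred_L1Cfg.
  apply: mpred_not.
  apply: (measurable_coords_preimage
    (s := fun p : L1Cfg => (fun u => spin p u (+) (u \in block S)) : config) _ mG) => u.
  apply: mpred_addb; last exact: mpred_cst.
  by apply: (measurable_coords_spin (p := fun p : L1Cfg => p)) => e; exact: mpred_L1Cfg.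
have mphi (F : set L1Cfg) : measurable F -> mpred (fun w : Cfg => F (phi1 w)).
  by move=> mF; apply: L1_preimage mF; exact: mpred_phi1.
have flipK : involutive (flipS S).
  by move=> p; apply/funext => e; rewrite /flipS; case: (side_of S e); rewrite ?negbK.
have flipE : flipS S @` E = flipS S @^-1` E.
  by apply/seteqP; split=> [_ [p Ep <-]|p Ep]; [rewrite /= flipK|exists (flipS S p)].
have mFE0 : mpred (fun p : L1Cfg => badly (flipS S p)).
  apply: (L1_preimage (p := flipS S : L1Cfg -> L1config) _ mE) => e.
  rewrite /flipS; case: (side_of S e); last exact: mpred_L1Cfg.
  by apply: mpred_neg; exact: mpred_L1Cfg.
have mFE : measurable (flipS S @` E : set L1Cfg).
  by move: mFE0; congr measurable; apply/esym/flipE.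
have FE0 : mu (phi1 @^-1` (flipS S @` E)) = 0%E.
  apply/(ae_null (mphi _ mFE)); move: Gsg; apply: ae_imp => w Gw.
  move=> [p [pc nG] pw]; apply: nG; apply: Ginv Gw.
  by rewrite /sigma -pw; exact: spin_flip.
have E0 : mu (phi1 @^-1` E) = 0%E.
  apply/eqP; rewrite eq_le measure_ge0 andbT leNgt; apply/negP => /(A4 S2 mE).
  by rewrite FE0 ltxx.
move: HOmega ((ae_null (mphi _ mE)).2 E0); apply: ae_imp2 => w wO nE.
apply: contrapT => nG; apply: nE; split=> //; exact: closed_phi1.
Qed.

Lemma ae_all (T : countType) (P : T -> Cfg -> Prop) :
  (forall t, {ae mu, forall w, P t w}) -> {ae mu, forall w, forall t, P t w}.
Proof.
move=> aeP; pose P' n w := if unpickle n is Some t then P t w else True.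
have aeP' n : {ae mu, forall w, P' n w}.
  by rewrite /P'; case: (unpickle n) => [t|]; [exact: aeP|exact: aeW].
move: (ae_foralln aeP'); apply: ae_imp => w h t.
by have := h (pickle t); rewrite /P' pickleK.
Qed.

Lemma ae_blocks (G : config -> Prop) : mpred (fun w : Cfg => G w) ->
  (forall s' s, sim 0 s' s -> G s' -> G s) -> {ae mu, forall w : Cfg, G (sigma w)} ->
  {ae mu, forall w : Cfg, forall l, all evenZ2 l ->
    G (fun u => sigma w u (+) block_sum l u)}.
Proof.
move=> mG Ginv Gsg; apply: ae_all => l; elim: l => [|S l IH].
  by move: Gsg; apply: ae_imp => w Gw _; apply: Ginv Gw => u v; rewrite !shift0 !addbF.
have [/= /andP[S2 l2]|h] := boolP (all evenZ2 (S :: l)); last exact: aeW.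
pose Gl s := G (fun u => s u (+) block_sum l u).
have mGl : mpred (fun w : Cfg => Gl w).
  apply: (measurable_coords_preimage
    (s := fun w : Cfg => (fun u => w u (+) block_sum l u) : config) _ mG) => u.
  by apply: mpred_addb; [exact: mpred_Cfg|exact: mpred_cst].
have Gl_inv s' s : sim 0 s' s -> Gl s' -> Gl s.
  move=> ss; apply: Ginv => u v; have := ss u v; rewrite !shift0.
  by case: (s' u); case: (s' v); case: (s u); case: (s v) => // _;
    case: (block_sum l u); case: (block_sum l v).
have Gl_sigma : {ae mu, forall w : Cfg, Gl (sigma w)} by move: IH; apply: ae_imp => w; exact.
move: (ae_flip S2 mGl Gl_inv Gl_sigma); apply: ae_imp => w Gw _.
apply: Ginv Gw => u v; rewrite !shift0 /=.
by rewrite -!addbA !(addbC (_ \in _)).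
Qed.

Lemma sum_measure_le (I : Type) (l : seq I) (A : I -> set Cfg) (c : nat) :
  (forall i, measurable (A i)) ->
  (forall w, (count (fun i => `[< A i w >]) l <= c)%N) ->
  (\sum_(i <- l) mu (A i) <= c%:R%:E)%E.
Proof.
move=> mA Ac.
have -> : (\sum_(i <- l) mu (A i) = \int[mu]_w (\sum_(i <- l) (\1_(A i) w)%:E))%E.
  rewrite ge0_integral_sum //.
    by apply: eq_bigr => i _; rewrite integral_indic // setIT.
  by move=> i; apply/measurable_EFinP; exact: measurable_indic.
have sumE w : (\sum_(i <- l) (\1_(A i) w)%:E =
    (count (fun i => `[< A i w >]) l)%:R%:E :> \bar R)%E.
  elim: l {Ac} => [|i l IH]; first by rewrite big_nil.
  rewrite big_cons IH /= natrD EFinD indicE.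
  by have -> : (w \in A i) = `[< A i w >] by apply/idP/asboolP; rewrite inE.
rewrite (_ : c%:R%:E = \int[mu]_w (cst c%:R%:E w))%E; last first.
  rewrite integral_cst // -[LHS]mule1; congr (_ * _)%E.
  exact/esym/probability_setT.
apply: ge0_le_integral => //.
- by move=> w _; apply: sume_ge0 => i _; rewrite lee_fin.
- by apply: emeasurable_sum => i; apply/measurable_EFinP; exact: measurable_indic.
- by move=> w _; rewrite sumE lee_fin ler_nat.
Qed.

(* All M^2 tiles of a big square are trifurcations with the same probability p, and at
   most 4ML of them are at once, so M p <= 4L for every M. *)
Lemma no_trifurcation a n : evenZ2 a ->
  {ae mu, forall w : Cfg, ~ trifurcation (tile a n.*2) (sigma w)}.
Proof.
move=> a2; pose L := n.*2.
pose P a (w : Cfg) := in_Omega w /\ trifurcation (tile a L) (sigma w).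
have mP a' : mpred (P a').
  apply: mpred_and; first exact: mpred_Omega.
  exact: mpred_trifurcation measurable_coords_sigma _.
have Pt a' : evenZ2 a' -> mu [set w | P a' w] = mu [set w | P (0, 0) w].
  move=> ev; rewrite -(mu_transl (a := a') _ (mP (0, 0))); last by move: ev => /andP[]; lia.
  have tileE x : (x \in tile (0, 0) L) = (shift a' x \in tile a' L).
    by rewrite !mem_tile /=; lia.
  congr (mu _); apply/seteqP; split=> w /= -[wO tri].
    split; first by apply: transl_Omega wO; move: ev => /andP[]; lia.
    apply: (trifurcation_sim (sim_opp (sigma_translate ev wO)) _ tri) => x.
    by rewrite tileE shiftNK.
  have wO' := Omega_transl ev wO; split=> //.
  exact: (trifurcation_sim (sigma_translate ev wO') tileE tri).
suff p0 : mu [set w | P (0, 0) w] = 0%E.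
  have := (ae_null (mP a)).2; rewrite (Pt _ a2) => /(_ p0) nP.
  by move: HOmega nP; apply: ae_imp2 => w wO nP tri; apply: nP.
have pfin : mu [set w | P (0, 0) w] \is a fin_num by apply: fin_num_measure; exact: mP.
set p := fine (mu [set w | P (0, 0) w]).
have pE : mu [set w | P (0, 0) w] = p%:E by rewrite fineK.
have p_ge0 : 0 <= p by rewrite fine_ge0.
have bound M : (M * M)%:R * p <= (4 * (M * L))%:R.
  pose l := [seq (i, j) | i <- iota 0 M, j <- iota 0 M].
  pose A i := [set w | P ((L * i.1)%N%:Z, (L * i.2)%N%:Z) w].
  rewrite -lee_fin; apply: le_trans (sum_measure_le (l := l) (A := A) (c := 4 * (M * L)) _ _).
  - rewrite (eq_bigr (fun=> p%:E)).
      rewrite sumEFin big_const_seq count_predT iter_addr_0.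
      by rewrite size_allpairs !size_iota mulr_natl.
    by move=> i _; rewrite -pE; apply: Pt; apply/andP; split=> /=; rewrite /L; lia.
  - by move=> i; exact: mP.
  - move=> w; apply: leq_trans (trifurcation_tiles (sigma w) L M).
    by apply: sub_count => i /asboolP[_ tri]; apply/asboolP.
rewrite pE; apply/eqP; rewrite eqe eq_le p_ge0 andbT leNgt; apply/negP => p_gt0.
pose M := (Num.trunc ((4 * L)%:R / p)).+1.
have : (4 * L)%:R < M%:R * p.
  rewrite -ltr_pdivrMr //; apply: truncnS_gt.
have := bound M; rewrite natrM -mulrA (_ : (4 * (M * L))%N = (M * (4 * L))%N); last by lia.
by rewrite natrM ler_pM2l ?ltr0n // => h1 /(le_lt_trans h1); rewrite ltxx.
Qed.

Lemma ae_False (P : Cfg -> Prop) : {ae mu, forall w : Cfg, False} -> {ae mu, forall w, P w}.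
Proof. by apply: ae_imp => w. Qed.

Lemma mpred_exists_dominant : mpred (fun w : Cfg => exists u, dominant w u).
Proof. by apply: mpred_ex => u; apply: mpred_dominant => v; exact: mpred_Cfg. Qed.

Lemma no_dominant : {ae mu, forall w : Cfg, ~ exists u, dominant (sigma w) u}.
Proof.
have Ginv : sim_invariant (fun s => exists u, dominant s u).
  by move=> a s' s ss [u du]; exists (shift a u); exact: (dominant_sim ss).
have [//|dom] := zero_one_sigma mpred_exists_dominant Ginv.
have dom' := ae_tau mpred_exists_dominant Ginv dom.
pose Q s t u v := dominant s u /\ dominant t v.
have mQ u v : mpred (fun w : Cfg => Q (sigma w) (tau w) u v).
  apply: mpred_and; apply: mpred_dominant; first exact: measurable_coords_sigma.
  exact: measurable_coords_tau.
have Qsim a s' s t' t u v : sim a s' s -> sim a t' t -> Q s' t' u v ->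
    Q s t (shift a u) (shift a v).
  by move=> ss tt [du dv]; split; [exact: (dominant_sim ss)|exact: (dominant_sim tt)].
move: dom dom' (parity_ae mQ Qsim); apply: ae_imp3 => w [u du] [v dv] h _; apply: h.
split; first by exists u, v.
by move=> x y x' y' [dx dy] [dx' dy']; rewrite (dominant_sign dx dx') (dominant_sign dy dy').
Qed.

Lemma ae_well_behaved : {ae mu, forall w : Cfg, well_behaved (sigma w)}.
Proof.
pose G s := (~ exists u, dominant s u) /\
  forall a n, evenZ2 a -> ~ trifurcation (tile a n.*2) s.
have mG : mpred (fun w : Cfg => G w).
  apply: mpred_and; first by apply: mpred_not; exact: mpred_exists_dominant.
  apply: mpred_all => a; apply: mpred_all => n; apply: mpred_imp; first exact: mpred_cst.
  by apply: mpred_not; apply: mpred_trifurcation => u; exact: mpred_Cfg.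
have Ginv s' s : sim 0 s' s -> G s' -> G s.
  move=> ss [nd nt]; split.
    by move=> [u du]; apply: nd; exists (shift (- 0) u); exact: (dominant_sim (sim_opp ss)).
  move=> a n a2 tri; apply: (nt a n a2); apply: (trifurcation_sim (sim_opp ss) _ tri) => x.
  by rewrite (_ : shift _ x = x) //; exact: shift0.
have Gsg : {ae mu, forall w : Cfg, G (sigma w)}.
  have nt : {ae mu, forall w : Cfg, forall a n,
      evenZ2 a -> ~ trifurcation (tile a n.*2) (sigma w)}.
    apply: ae_all => a; apply: ae_all => n.
    have [a2|a2] := boolP (evenZ2 a); last exact: aeW.
    by move: (no_trifurcation n a2); apply: ae_imp => w h _.
  by move: no_dominant nt; apply: ae_imp2 => w; split.
move: HOmega (ae_blocks mG Ginv Gsg); apply: ae_imp2 => w wO Gw.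
have Gfill a n c : evenZ2 a -> G (fill (tile a n.*2) c (sigma w)).
  move=> a2; have [l el ->] := fill_blocks n c (fun u v => @sigma_block w u v wO) a2.
  exact: Gw.
have nd u : ~ dominant (sigma w) u.
  move=> du; have [nd _] := Gw [::] isT; apply: nd; exists (shift 0 u).
  by apply: dominant_sim du => x y; rewrite !shift0 /= !addbF.
have n3 : ~ three_alike (sigma w).
  move=> [x [xi xs xN]]; have [n cover] := tile_cover (map x (enum 'I_3)).
  have [|_ nt] := Gfill (- (2 * n%:Z), - (2 * n%:Z)) (2 * n)%N (sigma w (x ord0)).
    by apply/andP; split=> /=; lia.
  apply: (nt (- (2 * n%:Z), - (2 * n%:Z)) (2 * n)%N); first by apply/andP; split=> /=; lia.
  apply: (fill_trifurcation (x := x)) => // a.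
  by apply: cover; rewrite map_f // mem_enum.
split=> [[u /nd]//|[u [v [ui vi suv uv]]]].
have [n cover] := tile_cover [:: u; v].
have [|nd' _] := Gfill (- (2 * n%:Z), - (2 * n%:Z)) (2 * n)%N (sigma w u).
  by apply/andP; split=> /=; lia.
apply: nd'; apply: (fill_dominant (u := u) (v := v)) => //.
- exact: tile_connected.
- by apply: cover; rewrite inE eqxx.
- by apply: cover; rewrite !inE eqxx orbT.
Qed.

Lemma no_infinite : {ae mu, forall w : Cfg, ~ exists u, infinite_in (sigma w) u}.
Proof.
have mG : mpred (fun w : Cfg => exists u, infinite_in w u).
  by apply: mpred_ex => u; apply: mpred_infinite => v; exact: mpred_Cfg.
have Ginv : sim_invariant (fun s => exists u, infinite_in s u).
  by move=> a s' s ss [u ui]; exists (shift a u); exact: (infinite_sim ss).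
have [//|si] := zero_one_sigma mG Ginv.
have ti := ae_tau mG Ginv si.
have twb : {ae mu, forall w : Cfg, well_behaved (tau w)}.
  apply: ae_tau ae_well_behaved.
    apply: mpred_and; first by apply: mpred_not; exact: mpred_exists_dominant.
    apply: mpred_not; apply: mpred_ex => u; apply: mpred_ex => v; apply: mpred_and4.
    - by apply: mpred_infinite => x; exact: mpred_Cfg.
    - by apply: mpred_infinite => x; exact: mpred_Cfg.
    - by apply: mpred_eq; exact: mpred_Cfg.
    - by apply: mpred_not; apply: mpred_cluster => x; exact: mpred_Cfg.
  move=> a s' s ss [nd n2]; split.
    by move=> [u du]; apply: nd; exists (shift (- a) u); exact: (dominant_sim (sim_opp ss)).
  move=> [u [v [ui vi suv uv]]]; apply: n2; exists (shift (- a) u), (shift (- a) v).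
  have ss' := sim_opp ss; split.
  - exact: (infinite_sim ss').
  - exact: (infinite_sim ss').
  - exact/(sign_sim ss').
  - by move=> /(cluster_simE ss').
have mF (f : Cfg -> config) u : measurable_coords f -> mpred (fun w : Cfg => facing (f w) u).
  by move=> mf; exact: mpred_facing.
have ps : {ae mu, forall w : Cfg,
    ~ ((exists u v, u = v /\ facing (sigma w) v) /\ forall u v u' v',
      u = v /\ facing (sigma w) v -> u' = v' /\ facing (sigma w) v' ->
      sigma w u (+) tau w v = sigma w u' (+) tau w v')}.
  apply: (parity_ae (Q := fun s t u v => u = v /\ facing s v)).
    move=> u v; apply: mpred_and; first exact: mpred_cst.
    by apply: mF; exact: measurable_coords_sigma.
  by move=> a s' s t' t u v ss tt [-> Fv]; split=> //; exact: (facing_sim ss Fv).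
have pt : {ae mu, forall w : Cfg,
    ~ ((exists u v, u = v /\ facing (tau w) v) /\ forall u v u' v',
      u = v /\ facing (tau w) v -> u' = v' /\ facing (tau w) v' ->
      sigma w u (+) tau w v = sigma w u' (+) tau w v')}.
  apply: (parity_ae (Q := fun s t u v => u = v /\ facing t v)).
    move=> u v; apply: mpred_and; first exact: mpred_cst.
    by apply: mF; exact: measurable_coords_tau.
  by move=> a s' s t' t u v ss tt [-> Fv]; split=> //; exact: (facing_sim tt Fv).
have pst : {ae mu, forall w : Cfg,
    ~ ((exists u v, facing (tau w) u /\ facing (sigma w) v) /\ forall u v u' v',
      facing (tau w) u /\ facing (sigma w) v -> facing (tau w) u' /\ facing (sigma w) v' ->
      sigma w u (+) tau w v = sigma w u' (+) tau w v')}.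
  apply: (parity_ae (Q := fun s t u v => facing t u /\ facing s v)).
    move=> u v; apply: mpred_and; apply: mF; first exact: measurable_coords_tau.
    exact: measurable_coords_sigma.
  by move=> a s' s t' t u v ss tt [Fu Fv]; split;
    [exact: (facing_sim tt Fu)|exact: (facing_sim ss Fv)].
have infs : {ae mu, forall w : Cfg,
    (exists u, infinite_in (sigma w) u) /\ exists u, infinite_in (tau w) u}.
  by move: si ti; apply: ae_imp2 => w; split.
have wbs : {ae mu, forall w : Cfg, well_behaved (sigma w) /\ well_behaved (tau w)}.
  by move: ae_well_behaved twb; apply: ae_imp2 => w; split.
have Owb : {ae mu, forall w : Cfg,
    [/\ in_Omega w, well_behaved (sigma w) & well_behaved (tau w)]}.
  by move: HOmega wbs; apply: ae_imp2 => w wO [].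
apply: ae_False; move: (ae_imp3 (fun w a b c => And3 a b c) infs Owb pst) ps pt.
apply: ae_imp3 => w [[[u ui] [u' ti']] [wO wbsg wbtg] pstw] psw ptw.
have st := sigma_tau_compat wO.
have [v Fv] : exists v, facing (sigma w) v.
  by case: wbsg => nd n2; apply: facing_infinite ui => x dx; apply: nd; exists x.
have [v' Fv'] : exists v, facing (tau w) v.
  by case: wbtg => nd n2; apply: facing_infinite ti' => x dx; apply: nd; exists x.
have tconst : forall x y, facing (sigma w) x -> facing (sigma w) y -> tau w x = tau w y.
  apply: facing_uniform st wbsg _ _; first by exists v.
  move=> h; apply: psw; split; first by exists v, v.
  by move=> x y x' y' [-> Fy] [-> Fy']; exact: h.
have sconst : forall x y, facing (tau w) x -> facing (tau w) y -> sigma w x = sigma w y.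
  apply: facing_uniform (compatC st) wbtg _ _; first by exists v'.
  move=> h; apply: ptw; split; first by exists v', v'.
  by move=> x y x' y' [-> Fy] [-> Fy']; rewrite addbC (addbC (sigma w y')); exact: h.
apply: pstw; split; first by exists v', v.
move=> x y x' y' [Fx Fy] [Fx' Fy'].
by rewrite (sconst x x') // (tconst y y').
Qed.

End Measure.

Theorem theorem1p3 (R : realType) (mu : probability Cfg R)
  (HOmega : {ae mu, forall w : Cfg, in_Omega w})
  (A1 : forall (k l : int) (A : set Cfg), measurable A ->
          mu (transl (k + l, k - l) @^-1` A) = mu A)
  (A2 : forall A : set Cfg, measurable A ->
          (forall k l : int, transl (2 * k, 2 * l) @^-1` A = A) ->
          mu A = 0%E \/ mu A = 1%E)
  (A3 : forall A : set Cfg, measurable A -> mu (theta @^-1` A) = mu A)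
  (A4 : forall (S : Z2), evenZ2 S -> forall E : set L1Cfg, measurable E ->
          (0 < mu (phi1 @^-1` E))%E ->
          (0 < mu (phi1 @^-1` (flipS S @` E)))%E) :
  {ae mu, forall w : Cfg, forall u : Z2, finite_set [set v | conn_minus w u v]}.
Proof.
move: HOmega (no_infinite HOmega A1 A2 A3 A4); apply: ae_imp2 => w wO ninf u.
have [l lP] : exists l : seq Z2, forall v, cluster (sigma w) u v -> v \in l.
  apply: contrapT => h; apply: ninf; exists u => l; apply: contrapT => h'.
  apply: h; exists l => v uv; apply: contrapT => vl; apply: h'; exists v => //.
  exact/negP.
apply: sub_finite_set (finite_seq l) => v uv; apply: lP.
elim: uv => [x y /(adj_minusE wO) xy|x|x y z _ xy _ yz].
- exact: con_step.
- exact: con_refl.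
- exact: con_trans xy yz.
Qed.
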